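(* Let $h \geq 2$ be an integer and let $$D_1 := B_1 - \log h - \mathcal{L}_h(2h).$$ Then, as the real variable $x\to\infty$, $$\sum_{\substack{n \leq x \\ n \in \mathcal{N}_h}} \omega_h(n) = \gamma_{0,h}\, x^{1/h}\log\log x + D_1\gamma_{0,h}\, x^{1/h} + O_h\!\left(\frac{x^{1/h}}{\log x}\right).$$ Moreover, $$\sum_{\substack{n \leq x \\ n \in \mathcal{N}_h}} \omega_{h+1}(n) = \left(\mathcal{L}_h(h+1)-\mathcal{L}_h(h+2)\right)\gamma_{0,h}\, x^{1/h} + O_h\!\left(x^{1/(h+1)}\log\log x\right),$$ and for every integer $k > h+1$, $$\sum_{\substack{n \leq x \\ n \in \mathcal{N}_h}} \omega_k(n) = \left(\mathcal{L}_h(k)-\mathcal{L}_h(k+1)\right)\gamma_{0,h}\, x^{1/h} + O_{h,k}\!\left(x^{1/(h+1)}\right).$$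
   Context: For natural numbers $n,k$, $\omega_k(n)$ is the number of distinct primes $p$ with $p^k \,\|\, n$ (i.e. $p^k \mid n$ and $p^{k+1}\nmid n$). For an integer $h\ge 2$, a natural number $n$ is $h$-full if every prime dividing $n$ has multiplicity at least $h$ in $n$; $\mathcal{N}_h$ is the set of $h$-full natural numbers (so $1 \in\mathcal{N}_h$). Sums and products over $p$ run over all primes. Define $$\gamma_{0,h} := \prod_p\left(1+\frac{p-p^{1/h}}{p^2(p^{1/h}-1)}\right),$$ and, for real $r>h$, the convergent sum $$\mathcal{L}_h(r) := \sum_p \frac{1}{p^{(r/h)-1}\left(p-p^{1-1/h}+1\right)}.$$ $B_1$ is the Mertens constant $B_1 = \gamma + \sum_p\left(\log\left(1-\frac1p\right)+\frac1p\right)$, with $\gamma$ the Euler–Mascheroni constant. $O_h$ (resp. $O_{h,k}$) means that the implied constant depends only on $h$ (resp. on $h$ and $k$); the estimates are asymptotic, i.e. hold for all sufficiently large real $x$. *)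

(* Defs.v *)
From mathcomp Require Export all_boot all_order all_algebra.
From mathcomp Require Export all_classical all_reals all_analysis.
Export Order.TTheory GRing.Theory Num.Theory.
Export numFieldNormedType.Exports.

Set Implicit Arguments.
Unset Strict Implicit.
Unset Printing Implicit Defensive.

Local Open Scope classical_set_scope.
Local Open Scope ring_scope.

(* Makes the filter [+oo] usable in the Landau notations [f = g +O_+oo e]. *)
Canonical pinfty_filter_on (R : realType) :=
  FilterType (pinfty_nbhs R) (@proper_pinfty_nbhs R).

(* The enumeration [primes n] loses nothing when [0 < k] and [0 < n]: then
   [p ^ k %| n] forces [p] to be one of the prime divisors of [n]. *)
Definition omega (k n : nat) : nat :=
  count (fun p : nat => (p ^ k %| n)%N && ~~ (p ^ k.+1 %| n)%N) (primes n).

(* The condition [0 < n] excludes [n = 0], for which [primes 0 = [::]]. *)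
Definition h_full (h n : nat) : bool :=
  (0 < n)%N && all (fun p : nat => h <= logn p n)%N (primes n).

Definition sum_omega (R : realType) (h k : nat) (x : R) : R :=
  \sum_(1 <= n < (Num.truncn x).+1 | h_full h n) (omega k n)%:R.

Definition gamma0 (R : realType) (h : nat) : R :=
  limn (fun N : nat => \prod_(0 <= p < N | prime p)
    (1 + (p%:R - p%:R `^ h%:R^-1) / (p%:R ^+ 2 * (p%:R `^ h%:R^-1 - 1)) : R)).

Definition Lh (R : realType) (h : nat) (r : R) : R :=
  limn (fun N : nat => \sum_(0 <= p < N | prime p)
    (p%:R `^ (r / h%:R - 1) * (p%:R - p%:R `^ (1 - h%:R^-1) + 1))^-1).

Definition euler_gamma (R : realType) : R :=
  limn (fun N : nat => \sum_(1 <= j < N.+1) (j%:R^-1 : R) - ln N%:R).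

Definition mertens_B1 (R : realType) : R :=
  euler_gamma R + limn (fun N : nat => \sum_(0 <= p < N | prime p)
    (ln (1 - p%:R^-1) + p%:R^-1 : R)).

(* Main.v *)
Require Import Defs.
From mathcomp Require Import ring lra zify.

(* A number [n] is [h]-full iff it is, in a unique way, [a ^ h * b] where all prime
   exponents of [b] lie in [h+1 .. 2h-1]. The sum of [b ^ (-1/h)] over such [b] has the
   Euler product [gamma0], while the number of [b <= y] is [O(y ^ (1/(h+1)))]. Counting
   the [a]'s, the number of [h]-full [m <= y] prime to [p] is
   [gamma0 * d_p * y ^ (1/h) + O(y ^ (1/(h+1)))] uniformly in [p] and [y > 0], with
   [d_p = (1 - 1/p) / (Euler factor at p)]. The sum of [omega k n] is the sum over [p]
   of this count at [y = x / p ^ k], and [d_p * p ^ (-k/h)] is the difference of the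
   terms of [Lh k] and [Lh (k+1)] at [p] (of [1/p] and the term of [Lh (2h)] if
   [k = h]). For [k > h] what remains are convergent sums, or the sum of [1/p] in the
   error term when [k = h+1]. For [k = h] only primes [p <= x ^ (1/h)] count: the main
   term is Mertens' second theorem and the error term is bounded by Chebyshev's.

   Mertens' theorem with some constant [M] follows from [ln n!]. To identify [M], let
   [q = exp(-e)] and group the primes by the integral part of [ln p]: by summation by
   parts, the sum of [p ^ (-1-e)] is that of [q ^ j / j], which is [- ln (1 - q)], plus
   [M - gamma + o(1)] as [e] tends to 0. By the Euler product it is also
   [ln (zeta (1+e)) = - ln e + o(1)] up to the convergent sum of
   [ln (1 - 1/p) + 1/p]. *)

Local Open Scope classical_set_scope.
Local Open Scope ring_scope.

Set Implicit Arguments.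
Unset Strict Implicit.
Unset Printing Implicit Defensive.

(** * Real-analysis preliminaries *)

(** For [k = h] the error exponent leaves no room: the sum of (x / p^h)^(1/(h+1)) over p <= z =
    x^(1/h) is x^(1/(h+1)) times a sum of p^(-h/(h+1)). Over all integers up to z the latter would
    have order z^(1/(h+1)), and the product would be x^(1/h) exactly. The saving of ln x comes only
    from the scarcity of primes, hence the need for Chebyshev's bound.

    The local identities are algebra in t = p^(-1/h): d_p is (1 - t) / (1 - t + t^h) and the term of
    [Lh k] is t^k / (1 - t + t^h). For [k = h] the difference of two such terms is useless, since
    the sum of the first ones diverges. Writing 1 - t as (1 - t + t^h) - t^h splits off 1/p instead
    and leaves the term of [Lh (2h)].

    The constants are given by [limn], so each needs a proof of convergence. Apart from that, the
    estimates compare finite sums and finite Euler products, with explicit constants. *)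

Lemma limn_le_from (R : realType) (u : nat -> R) (n0 : nat) (c : R) :
  cvgn u -> (forall m, (n0 <= m)%N -> u m <= c) -> limn u <= c.
Proof. by move=> cu uc; apply: limr_le => //; exists n0 => // m /= /uc. Qed.

Lemma limn_ge_from (R : realType) (u : nat -> R) (n0 : nat) (c : R) :
  cvgn u -> (forall m, (n0 <= m)%N -> c <= u m) -> c <= limn u.
Proof. by move=> cu uc; apply: limr_ge => //; exists n0 => // m /= /uc. Qed.

Lemma telescope_dist (R : realDomainType) (G H : nat -> R) (n0 : nat) :
  (forall n, (n0 <= n)%N -> `|G n.+1 - G n| <= H n - H n.+1) ->
  forall n m, (n0 <= n <= m)%N -> `|G m - G n| <= H n - H m.
Proof.
move=> dG n m /andP[n0n]; elim: m => [|m IHm].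
  by rewrite leqn0 => /eqP ->; rewrite !subrr normr0.
rewrite leq_eqVlt => /orP[/eqP ->|]; first by rewrite !subrr normr0.
rewrite ltnS => nm; have := dG m (leq_trans n0n nm).
have := IHm nm; have := ler_normD (G m.+1 - G m) (G m - G n).
rewrite addrA subrK; lra.
Qed.

(** [H] is nonincreasing and [G - H] nondecreasing, so both converge. This yields a limit together
    with a rate, and serves for Mertens' second theorem, for Euler's constant and for the series in
    [mertens_B1]. *)
Lemma cvg_telescope (R : realType) (G H : nat -> R) (n0 : nat) :
  (forall n, 0 <= H n) ->
  (forall n, (n0 <= n)%N -> `|G n.+1 - G n| <= H n - H n.+1) ->
  cvgn G /\ forall n, (n0 <= n)%N -> `|G n - limn G| <= H n.
Proof.
move=> H0 dG; have GH := telescope_dist dG.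
have dH n : (n0 <= n)%N -> H n.+1 <= H n.
  by move=> /dG; have := normr_ge0 (G n.+1 - G n); lra.
pose H' n := H (n + n0)%N; pose G' n := G (n + n0)%N.
have cH : cvgn H'.
  apply: nonincreasing_is_cvgn; last by exists 0 => _ [n _ <-]; exact: H0.
  by apply/nonincreasing_seqP => n; apply: dH; rewrite leq_addl.
have cGH : cvgn (G' - H').
  apply: nondecreasing_is_cvgn.
    apply/nondecreasing_seqP => n; have := dG (n + n0)%N (leq_addl _ _).
    rewrite ler_norml !fctE /G' /H' addSn; lra.
  exists (G' 0%N + H' 0%N) => _ [n _ <-].
  have := GH n0 (n + n0)%N; rewrite leqnn leq_addl => /(_ isT).
  rewrite ler_norml !fctE /G' /H' add0n; have := H0 (n + n0)%N; lra.
have cG' : cvgn G'.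
  by have -> : G' = (G' - H') + H'; [rewrite subrK|exact: is_cvgD].
have cG : cvgn G by apply/cvg_ex; case/cvg_ex: cG' => l; rewrite cvg_shiftn; exists l.
split=> // n n0n; have Gn m : (n <= m)%N -> G n - H n <= G m <= G n + H n.
  move=> nm; have := GH n m; rewrite n0n nm => /(_ isT).
  by have := H0 m; rewrite ler_norml; lra.
rewrite ler_distlC; apply/andP; split.
  by apply: limn_ge_from cG _ => m /Gn /andP[].
by apply: limn_le_from cG _ => m /Gn /andP[].
Qed.

Lemma ln_le_subr1 (R : realType) (x : R) : 0 < x -> ln x <= x - 1.
Proof.
by move=> x0; have := @le_ln1Dx R (x - 1); rewrite (addrC 1) subrK; apply; lra.
Qed.

Lemma ln_ge_1subV (R : realType) (x : R) : 0 < x -> 1 - x^-1 <= ln x.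
Proof.
move=> x0; have := @ln_le_subr1 R x^-1; rewrite invr_gt0 => /(_ x0).
rewrite lnV ?posrE//; lra.
Qed.

(** Writing a ratio of powers as an exponential lets the linear bounds on [ln] and [expR] replace
    the mean value theorem in the next three lemmas. *)
Lemma powR_scale (R : realType) (a b s : R) : 0 < a -> 0 < b ->
  a `^ s = b `^ s * expR (s * ln (a / b)).
Proof.
move=> a0 b0; have -> : expR (s * ln (a / b)) = (a / b) `^ s.
  by rewrite /powR gt_eqF// divr_gt0.
by rewrite -powRM ?ltW ?divr_gt0// mulrCA divff ?mulr1// gt_eqF.
Qed.

Lemma powRV (R : realType) (a : R) : 0 < a -> a `^ (-1) = a^-1.
Proof. by move=> a0; rewrite powR_inv1 // ltW. Qed.

Lemma powR_invl (R : realType) (a s : R) : 0 < a -> a^-1 `^ s = a `^ (- s).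
Proof. by move=> a0; rewrite -powRV// -powRrM mulN1r. Qed.

Lemma powRNS (R : realType) (a s : R) : 0 < a -> a `^ (- (1 + s)) = a `^ (- s) / a.
Proof.
by move=> a0; rewrite opprD addrC powRD ?powRV// (gt_eqF a0) implybT.
Qed.

(** Together with [powRN_sub_le], this replaces the comparison of a sum of n^(-1-s) with an
    integral: the terms are bracketed by increments of n^(-s) / s. *)
Lemma powRN_sub_ge (R : realType) (a s : R) : 0 < a -> 0 < s ->
  s * (a + 1) `^ (- (1 + s)) <= a `^ (- s) - (a + 1) `^ (- s).
Proof.
move=> a0 s0; have b0 : 0 < a + 1 by lra.
rewrite powRNS// (powR_scale (- s) a0 b0).
have h1 : (a + 1)^-1 <= - ln (a / (a + 1)).
  have := @ln_le_subr1 R (a / (a + 1)) (divr_gt0 a0 b0).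
  have -> : a / (a + 1) = 1 - (a + 1)^-1 by field; lra.
  lra.
have h2 : 1 + s * (a + 1)^-1 <= expR (- s * ln (a / (a + 1))).
  apply: le_trans (expR_ge1Dx _); rewrite mulNr -mulrN lerD2l.
  by rewrite ler_wpM2l// ltW.
have P0 := powR_ge0 (a + 1) (- s); nra.
Qed.

Lemma powRN_sub_le (R : realType) (a s : R) : 0 < a -> 0 < s ->
  a `^ (- s) - (a + 1) `^ (- s) <= s * a `^ (- (1 + s)).
Proof.
move=> a0 s0; have b0 : 0 < a + 1 by lra.
rewrite powRNS// (powR_scale (- s) b0 a0).
have h1 : ln ((a + 1) / a) <= a^-1.
  apply: le_trans (ln_le_subr1 (divr_gt0 b0 a0)) _.
  by rewrite mulrDl divff ?gt_eqF// mul1r; lra.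
have h2 : 1 - s * a^-1 <= expR (- s * ln ((a + 1) / a)).
  apply: le_trans (expR_ge1Dx _); rewrite mulNr lerD2l lerN2.
  by rewrite ler_wpM2l// ltW.
have P0 := powR_ge0 a (- s); nra.
Qed.

(** The factor 1/2 comes from exp(-u) <= 1/(1+u) <= 1 - u/2 for u in [0, 1], at u = s/(a+1). The
    case [a = 0] is included so that sums can start at their first term. *)
Lemma powR_sub_ge (R : realType) (a s : R) : 0 <= a -> 0 < s <= 1 ->
  s / 2 * (a + 1) `^ (s - 1) <= (a + 1) `^ s - a `^ s.
Proof.
move=> a0 /andP[s0 s1]; have b0 : 0 < a + 1 by lra.
have -> : (a + 1) `^ (s - 1) = (a + 1) `^ s / (a + 1).
  by rewrite powRD ?powRV// (gt_eqF b0) implybT.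
have P0 := powR_ge0 (a + 1) s.
have v0 : 0 < (a + 1)^-1 by rewrite invr_gt0.
have v1 : (a + 1)^-1 <= 1 by rewrite invf_le1//; lra.
set v := (a + 1)^-1 in v0 v1 *.
suff : a `^ s <= (a + 1) `^ s * (1 - s * v / 2) by lra.
move: a0; rewrite le_eqVlt => /orP[/eqP <-|a0].
  by rewrite powR0 ?gt_eqF// mulr_ge0//; nra.
rewrite (powR_scale s a0 b0) ler_wpM2l//.
have h1 : ln (a / (a + 1)) <= - v.
  apply: le_trans (ln_le_subr1 (divr_gt0 a0 b0)) _.
  have -> : a / (a + 1) = 1 - v by rewrite /v; field; lra.
  lra.
apply: (@le_trans _ _ (expR (- (s * v)))); first by rewrite ler_expR; nra.
have u0 : 0 < s * v by rewrite mulr_gt0.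
have u1 : s * v <= 1 by nra.
rewrite expRN; apply: (@le_trans _ _ (1 + s * v)^-1).
  by rewrite lef_pV2 ?posrE ?expR_gt0 ?expR_ge1Dx//; lra.
rewrite -div1r ler_pdivrMr; nra.
Qed.

Lemma sum_powR_tail (R : realType) (s : R) : 0 < s ->
  exists2 K : R, 0 < K & forall (z : R) (N : nat), 0 < z ->
    \sum_(0 <= n < N | z < n%:R) n%:R `^ (- (1 + s)) <= K * z `^ (- s).
Proof.
move=> s0; exists (s^-1 * 2 `^ (1 + s)); first by rewrite mulr_gt0 ?invr_gt0 ?powR_gt0.
set K := s^-1 * _ => z N z0; have K0 : 0 <= K by rewrite mulr_ge0 ?powR_ge0 ?invr_ge0 ?ltW.
(* Clamping at [z] lets the sum over all [n] telescope: the increments below [z] vanish, and [g 0]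
   is z^(-s). *)
pose g (n : nat) := Num.max z n%:R `^ (- s) : R.
have gD n : g n.+1 <= g n.
  rewrite /g !powRN lef_pV2 ?posrE ?powR_gt0 ?lt_max ?z0//.
  apply: ge0_ler_powR; rewrite ?nnegrE; first exact: ltW.
  - by rewrite le_max ltW.
  - by rewrite le_max ltW.
  - by rewrite ge_max !le_max lexx ler_nat leqnSn orbT.
apply: (@le_trans _ _ (\sum_(0 <= n < N) K * (g n - g n.+1))).
  rewrite big_mkcond /=; apply: ler_sum => n _; case: ifPn => zn; last first.
    by rewrite mulr_ge0// subr_ge0.
  have n0 : 0 < n%:R :> R by lra.
  have n1 : 1 <= n%:R :> R by rewrite ler1n -(ltr0n R).
  have := powRN_sub_ge n0 s0; rewrite /g !max_r ?(ltW zn)//; last first.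
    by rewrite -natr1; lra.
  set a := n%:R in n0 n1 *; rewrite -natr1 -/a => H.
  (* The factor 2^(1+s) in [K] pays for the shift from [a + 1] to [a], by a + 1 <= 2a. *)
  have H2 : a `^ (- (1 + s)) <= 2 `^ (1 + s) * (a + 1) `^ (- (1 + s)).
    rewrite !powRN -ler_pdivrMl ?powR_gt0// -invfM -powRM ?(ltW n0)//.
    rewrite lef_pV2 ?posrE ?powR_gt0 ?mulr_gt0//; last by lra.
    by apply: ge0_ler_powR; rewrite ?nnegrE; lra.
  apply: le_trans H2 _; have -> : 2 `^ (1 + s) * (a + 1) `^ (- (1 + s)) =
    K * (s * (a + 1) `^ (- (1 + s))) by rewrite /K; field; lra.
  by rewrite ler_wpM2l.
rewrite -mulr_sumr ler_wpM2l//.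
rewrite (eq_bigr (fun n => - g n.+1 - - g n)); last by move=> n _; ring.
rewrite telescope_sumr// opprK /g (max_l (ltW z0)) gerDr oppr_le0.
exact: powR_ge0.
Qed.

Lemma sum_powR_le (R : realType) (s : R) (N : nat) : 0 < s <= 1 ->
  \sum_(0 <= n < N) n.+1%:R `^ (s - 1) <= 2 / s * N%:R `^ s.
Proof.
move=> s01; have s0 : 0 < s by case/andP: s01.
apply: (@le_trans _ _ (\sum_(0 <= n < N) 2 / s * (n.+1%:R `^ s - n%:R `^ s))).
  apply: ler_sum => n _; have := powR_sub_ge (ler0n R n) s01.
  by rewrite natr1 -ler_pdivlMl ?divr_gt0// invf_div.
by rewrite -mulr_sumr telescope_sumr// powR0 ?gt_eqF// subr0.
Qed.

(** * Decomposition of h-full numbers *)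

(* Write an exponent [e >= h] of an [h]-full [n] as [h q + r] with [r < h]. Letting
   [p ^ q] go to [a] when [r = 0], and [p ^ (q - 1)] go to [a] and [p ^ (h + r)] go
   to [b] otherwise, makes [n = a ^ h * b] a bijection between [h]-full numbers and
   pairs [(a, b)] with [0 < a] and [hbase h b]. *)
Definition hbase (h b : nat) : bool :=
  (0 < b)%N && all (fun p : nat => h < logn p b < h.*2)%N (primes b).

Lemma h_fullP (h n : nat) : reflect
  ((0 < n)%N /\ forall p, prime p -> logn p n = 0%N \/ (h <= logn p n)%N)
  (h_full h n).
Proof.
apply: (iffP andP) => -[n0 H]; split=> //.
  move=> p pp; have [pn|] := boolP (p \in primes n).
    by right; move/allP: H; apply.
  by rewrite -logn_gt0 lt0n negbK => /eqP; left.
apply/allP => p; rewrite mem_primes => /and3P[pp _ pn].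
have : (0 < logn p n)%N by rewrite logn_gt0 mem_primes pp n0 pn.
by case: (H p pp) => // ->.
Qed.

Lemma hbaseP (h b : nat) : reflect
  ((0 < b)%N /\ forall p, prime p -> logn p b = 0%N \/ (h < logn p b < h.*2)%N)
  (hbase h b).
Proof.
apply: (iffP andP) => -[n0 H]; split=> //.
  move=> p pp; have [pn|] := boolP (p \in primes b).
    by right; move/allP: H; apply.
  by rewrite -logn_gt0 lt0n negbK => /eqP; left.
apply/allP => p; rewrite mem_primes => /and3P[pp _ pn].
have : (0 < logn p b)%N by rewrite logn_gt0 mem_primes pp n0 pn.
by case: (H p pp) => // ->.
Qed.

Lemma hbase_gt0 (h b : nat) : hbase h b -> (0 < b)%N.
Proof. by case/andP. Qed.

Lemma hbase_h_full (h b : nat) : hbase h b -> h_full h.+1 b.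
Proof.
move=> /hbaseP[b0 H]; apply/h_fullP; split=> // p /H [->|/andP[]]; [by left|by right].
Qed.

Lemma prod_primes_gt0 (s : seq nat) (e : nat -> nat) :
  all prime s -> (0 < \prod_(p <- s) p ^ e p)%N.
Proof.
move=> sp; rewrite big_seq prodn_cond_gt0// => p /(allP sp) /prime_gt0 p0.
by rewrite expn_gt0 p0.
Qed.

Lemma logn_prod_primes (s : seq nat) (e : nat -> nat) (q : nat) :
  uniq s -> all prime s ->
  logn q (\prod_(p <- s) p ^ e p)%N = (if q \in s then e q else 0)%N.
Proof.
elim: s => [|p s IHs] /=; first by rewrite big_nil logn1.
move=> /andP[ps us] /andP[pp sp].
have pe0 : (0 < p ^ e p)%N by rewrite expn_gt0 prime_gt0.
rewrite big_cons lognM ?prod_primes_gt0// IHs// lognX logn_prime// inE.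
have [->|qp] := eqVneq q p; first by rewrite (negbTE ps) muln1 addn0.
by rewrite muln0 add0n.
Qed.

Lemma prod_primes_logn (n : nat) : (0 < n)%N ->
  n = (\prod_(p <- primes n) p ^ logn p n)%N.
Proof.
move=> n0; have pn : all prime (primes n).
  by apply/allP => p; rewrite mem_primes => /andP[].
apply: eqn_from_log => //; first exact: prod_primes_gt0.
move=> q; rewrite logn_prod_primes ?primes_uniq//; case: ifPn => // qn.
by apply/eqP; rewrite -leqn0 leqNgt logn_gt0.
Qed.

(** The representative of [e] modulo [h] among 0 and the integers strictly between [h] and [2h]. *)
Definition hres (h e : nat) : nat := if (e %% h == 0)%N then 0%N else (h + e %% h)%N.

Lemma hres_uniq (h a r : nat) :
  (0 < h)%N -> (r = 0 \/ h < r < h.*2)%N -> hres h (h * a + r) = r.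
Proof.
rewrite /hres => h0 [->|/andP[h1 h2]].
  by rewrite addn0 modnMr.
have -> : (h * a + r)%N = (a.+1 * h + (r - h))%N by rewrite mulSn; lia.
rewrite modnMDl modn_small; last by lia.
by case: eqP; lia.
Qed.

Lemma hres_decomp (h e : nat) : (0 < h)%N -> (e = 0 \/ h <= e)%N ->
  e = (h * ((e - hres h e) %/ h) + hres h e)%N /\
  (hres h e = 0 \/ h < hres h e < h.*2)%N.
Proof.
move=> h0 he; have hm := ltn_pmod e h0; have E := divn_eq e h.
rewrite /hres; case: eqP => m0.
  by rewrite subn0 addn0; split; [rewrite {1}E m0 addn0 mulnC|left].
have e0 : (h <= e)%N by case: he m0 => [->|//]; rewrite mod0n.
have q0 : (0 < e %/ h)%N by rewrite divn_gt0.
split; last by right; lia.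
have -> : (e - (h + e %% h))%N = ((e %/ h).-1 * h)%N.
  by rewrite {1}E; case: (e %/ h)%N q0 => // q _; rewrite mulSn /=; lia.
rewrite mulnK// {1}E; case: (e %/ h)%N q0 => // q _ /=; rewrite mulSn; lia.
Qed.

Lemma h_full_decomp (h n : nat) : (0 < h)%N -> h_full h n ->
  exists a b, [/\ (0 < a)%N, hbase h b & n = (a ^ h * b)%N].
Proof.
move=> h0 /h_fullP[n0 nh]; have pn : all prime (primes n).
  by apply/allP => p; rewrite mem_primes => /andP[].
exists (\prod_(p <- primes n) p ^ ((logn p n - hres h (logn p n)) %/ h))%N.
exists (\prod_(p <- primes n) p ^ hres h (logn p n))%N; split.
- exact: prod_primes_gt0.
- apply/hbaseP; split=> [|p pp]; first exact: prod_primes_gt0.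
  rewrite logn_prod_primes ?primes_uniq//; case: ifP => _; last by left.
  by case: (hres_decomp h0 (nh p pp)).
rewrite {1}(prod_primes_logn n0).
rewrite (big_morph (expn^~ h) (fun x y => expnMn x y h) (exp1n h)) -big_split /=.
rewrite big_seq [RHS]big_seq.
apply: eq_bigr => p; rewrite mem_primes => /andP[pp _].
by rewrite -expnM -expnD mulnC -(hres_decomp h0 (nh p pp)).1.
Qed.

Lemma h_full_decomp_inj (h a b a' b' : nat) :
  (0 < h)%N -> (0 < a)%N -> (0 < a')%N -> hbase h b -> hbase h b' ->
  (a ^ h * b = a' ^ h * b')%N -> a = a' /\ b = b'.
Proof.
move=> h0 a0 a'0 /hbaseP[b0 Hb] /hbaseP[b'0 Hb'] E.
have bb : b = b'.
  apply: eqn_from_log => // p; have [pp|np] := boolP (prime p); last first.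
    by rewrite lognE [RHS]lognE (negbTE np).
  have := congr1 (logn p) E; rewrite !lognM ?expn_gt0 ?a0 ?a'0// !lognX => Ep.
  by rewrite -(hres_uniq (logn p a) h0 (Hb p pp)) Ep hres_uniq//; apply: Hb'.
split=> //; move/eqP: E; rewrite bb eqn_pmul2r// => /eqP E.
by apply/eqP; rewrite -(eqn_exp2r _ _ h0) E.
Qed.

Lemma h_full_mul (h a b : nat) : (0 < a)%N -> hbase h b -> h_full h (a ^ h * b).
Proof.
move=> a0 /hbaseP[b0 Hb]; apply/h_fullP; split.
  by rewrite muln_gt0 expn_gt0 a0.
move=> p pp; rewrite lognM ?expn_gt0 ?a0// lognX.
case: (Hb p pp) => [->|/andP[hb _]]; last by right; rewrite (leq_trans (ltnW hb)) ?leq_addl.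
by rewrite addn0; case: (logn p a) => [|m]; [left; rewrite muln0|right; rewrite leq_pmulr].
Qed.

(** Existence of the decomposition makes the list of products a^h * b complete, uniqueness makes it
    duplicate-free. Bounding [a] and [b] by [N] loses nothing, both being at most a^h * b. *)
Lemma sum_h_full (R : nmodType) (h N : nat) (F : nat -> R) : (0 < h)%N ->
  \sum_(0 <= n < N | h_full h n) F n =
  \sum_(0 <= b < N | hbase h b)
    \sum_(0 <= a < N | (0 < a)%N && (a ^ h * b < N)%N) F (a ^ h * b)%N.
Proof.
move=> h0; rewrite -big_filter -[RHS]big_filter.
under [RHS]eq_bigr do rewrite -big_filter.
rewrite -(@big_allpairs_dep _ _ _ _ (fun=> nat) _ (fun b a => a ^ h * b)%N _ _ F).
apply: perm_big; apply: uniq_perm.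
- by rewrite filter_uniq// iota_uniq.
- apply: allpairs_uniq_dep; rewrite ?filter_uniq ?iota_uniq//.
    by move=> b _; rewrite filter_uniq// iota_uniq.
  move=> _ _ /allpairsPdep[b [a [+ + ->]]] /allpairsPdep[b' [a' [+ + ->]]] /=.
  rewrite !mem_filter => /andP[hb _] /andP[/andP[a0 _] _].
  move=> /andP[hb' _] /andP[/andP[a'0 _] _] E.
  by case: (h_full_decomp_inj h0 a0 a'0 hb hb' E) => -> ->.
move=> n; rewrite mem_filter mem_index_iota /=; apply/andP/allpairsPdep.
  move=> [/(h_full_decomp h0)[a [b [a0 hb ->]]] nN].
  have b0 := hbase_gt0 hb; exists b, a; rewrite !mem_filter !mem_index_iota hb a0 nN /=.
  split=> //.
    by apply: leq_ltn_trans nN; rewrite leq_pmull// expn_gt0 a0.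
  apply: leq_ltn_trans nN; apply: (@leq_trans (a ^ h)%N); last by rewrite leq_pmulr.
  by rewrite -{1}(expn1 a) leq_pexp2l.
move=> [b [a [+ + ->]]]; rewrite !mem_filter => /andP[hb _] /andP[/andP[a0 ->] _].
by rewrite h_full_mul.
Qed.

(** * Reduction of the sum of [omega] to counts of h-full numbers prime to p *)

Definition h_full_count (R : realType) (h p : nat) (y : R) : R :=
  \sum_(0 <= m < (Num.truncn y).+1 | h_full h m && ~~ (p %| m)%N) 1.

Definition exact_pow (k p n : nat) : bool :=
  (p ^ k %| n)%N && ~~ (p ^ k.+1 %| n)%N.

(** Trades [primes n] for a range of [p] independent of [n], so that the sums over [n] and [p] can
    be exchanged. *)
Lemma omegaE (k n N : nat) : (0 < k)%N -> (0 < n < N)%N ->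
  omega k n = (\sum_(0 <= p < N | prime p && exact_pow k p n) 1)%N.
Proof.
move=> k0 /andP[n0 nN]; rewrite /omega -sum1_count -[LHS]big_filter -[RHS]big_filter.
apply: perm_big; apply: uniq_perm; rewrite ?filter_uniq ?primes_uniq ?iota_uniq//.
move=> p; rewrite !mem_filter mem_index_iota mem_primes n0 /= -/(exact_pow k p n).
have [pn|] := boolP (exact_pow k p n); last by rewrite andbF.
case: (boolP (prime p)) => //= pp.
have dpn : (p %| n)%N.
  by case/andP: pn => + _; apply: dvdn_trans; rewrite -{1}(expn1 p) dvdn_exp2l.
by rewrite dpn (leq_ltn_trans (dvdn_leq n0 dpn)).
Qed.

Lemma h_full_mul_pow (h k p m : nat) : prime p -> (h <= k)%N ->
  ~~ (p %| m)%N -> h_full h (p ^ k * m) = h_full h m.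
Proof.
move=> pp hk pm; have p0 := prime_gt0 pp.
have lm : logn p m = 0%N by apply/eqP; rewrite -leqn0 leqNgt logn_gt0 mem_primes (negbTE pm) !andbF.
apply/h_fullP/h_fullP => -[m0 H].
  have {}m0 : (0 < m)%N by move: m0; rewrite muln_gt0 => /andP[].
  split=> // q pq; have := H q pq; rewrite lognM ?expn_gt0 ?p0// lognX logn_prime//.
  have [->|qp] := eqVneq q p; first by rewrite lm; left.
  by rewrite muln0 add0n.
split=> [|q pq]; first by rewrite muln_gt0 expn_gt0 p0.
rewrite lognM ?expn_gt0 ?p0// lognX logn_prime//.
have [->|qp] := eqVneq q p; first by rewrite lm muln1 addn0; right.
by rewrite muln0 add0n; apply: H.
Qed.

(** The [n] exactly divisible by p^k are the p^k * m with [m] prime to [p]. Since h <= k, such an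
    [n] is [h]-full iff [m] is. *)
Lemma sum_omegaE (R : realType) (h k : nat) (x : R) : (0 < h)%N -> (h <= k)%N ->
  0 <= x -> sum_omega h k x =
  \sum_(0 <= p < (Num.truncn x).+1 | prime p) h_full_count h p (x / p%:R ^+ k).
Proof.
move=> h0 hk x0; have k0 := leq_trans h0 hk; rewrite /sum_omega.
set N := (Num.truncn x).+1.
transitivity (\sum_(0 <= n < N | h_full h n)
    \sum_(0 <= p < N | prime p && exact_pow k p n) (1 : R)).
  rewrite [RHS]big_ltn_cond//=.
  rewrite big_nat_cond [RHS]big_nat_cond; apply: eq_bigr => n /andP[n0N _].
  by rewrite (omegaE k0 n0N) natr_sum.
rewrite (exchange_big_dep_nat (fun p => prime p)) /=; last by move=> i j _ _ _ /andP[].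
rewrite big_nat_cond [RHS]big_nat_cond; apply: eq_bigr => p /andP[/andP[_ pN] pp].
have p0 := prime_gt0 pp; rewrite /h_full_count.
set M := (Num.truncn (x / _)).+1.
have MN m : (m < M)%N = (p ^ k * m < N)%N.
  have pk0 : 0 < p%:R ^+ k :> R by rewrite exprn_gt0// ltr0n.
  rewrite !ltnS !truncn_ge_nat ?divr_ge0 ?(ltW pk0)//.
  by rewrite ler_pdivlMr// natrM natrX mulrC.
rewrite -big_filter -[RHS]big_filter.
transitivity (\sum_(n <- [seq p ^ k * m | m <-
   [seq m <- index_iota 0 M | h_full h m && ~~ (p %| m)]]%N) (1:R)); last by rewrite big_map.
have pk0 : (0 < p ^ k)%N by rewrite expn_gt0 p0.
apply: perm_big; apply: uniq_perm.
- by rewrite filter_uniq// iota_uniq.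
- rewrite map_inj_uniq ?filter_uniq ?iota_uniq//.
  by move=> a b /eqP; rewrite eqn_pmul2l// => /eqP.
move=> n; rewrite mem_filter mem_index_iota /exact_pow; apply/idP/mapP.
  move=> /andP[/andP[nh /andP[_ /andP[/dvdnP[m nm]]]]]; move: nh; rewrite {}nm.
  rewrite (mulnC m) expnSr dvdn_pmul2l// => mh pm mN; exists m => //.
  by rewrite mem_filter mem_index_iota /= MN pm -(h_full_mul_pow pp hk pm) mh.
move=> [m + ->]; rewrite mem_filter mem_index_iota MN /= => /andP[/andP[mh pm] mN].
by rewrite h_full_mul_pow// mh pp mN dvdn_mulr// expnSr dvdn_pmul2l// pm.
Qed.

(** * Euler products over finite lists of integers *)

(** The integers arising in the expansion of the product, over q < N with [Q q], of the sums of q^e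
    for [e] in [S]. Since the list has no duplicates, comparing a finite Dirichlet sum with a finite
    Euler product becomes an inclusion of lists. *)
Fixpoint euler_list (Q : pred nat) (S : seq nat) (N : nat) : seq nat :=
  if N is N'.+1 then
    if Q N' then [seq (b * N' ^ e)%N | b <- euler_list Q S N', e <- S]
    else euler_list Q S N'
  else [:: 1%N].

Lemma mem_euler_list (Q : pred nat) (S : seq nat) (N n : nat) :
  (forall q, Q q -> prime q) ->
  n \in euler_list Q S N <-> (0 < n)%N /\ forall p, prime p ->
    if Q p && (p < N)%N then logn p n \in S else logn p n == 0%N.
Proof.
move=> Qp; elim: N n => [|N IHN] n /=.
  rewrite inE; split=> [/eqP ->|[n0 H]].
    by split=> // p _; rewrite ltn0 andbF logn1.
  apply/eqP/eqn_from_log => // p; rewrite logn1.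
  have [pp|np] := boolP (prime p); last by rewrite lognE (negbTE np).
  by have := H p pp; rewrite ltn0 andbF => /eqP.
case: ifPn => QN; last first.
  rewrite IHN; split=> -[n0 H]; split=> // p pp; have := H p pp.
    rewrite ltnS (leq_eqVlt p); have [->|pN] := eqVneq p N.
      by rewrite ltnn andbF (negbTE QN).
    by [].
  rewrite ltnS (leq_eqVlt p); have [->|pN] := eqVneq p N.
    by rewrite ltnn andbF (negbTE QN).
  by [].
have pN := Qp N QN; have pw e : (0 < N ^ e)%N by rewrite expn_gt0 prime_gt0.
split.
  move=> /allpairsP[[b e] /= [/IHN[b0 H] eS ->]].
  split=> [|p pp]; first by rewrite muln_gt0 b0 pw.
  rewrite lognM// lognX (logn_prime _ pN) ltnS (leq_eqVlt p).
  have := H p pp; have [->|pN'] := eqVneq p N.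
    by rewrite ltnn andbF QN /= => /eqP ->; rewrite muln1.
  by rewrite muln0 addn0.
move=> [n0 H]; have [m mN nE] := pfactor_coprime pN n0.
apply/allpairsP; exists (m, logn N n) => /=; split=> //; last first.
  by have := H N pN; rewrite QN ltnSn.
have m0 : (0 < m)%N by move: n0; rewrite nE muln_gt0 => /andP[].
apply/IHN; split=> // p pp; have := H p pp.
rewrite {1 2}nE lognM// lognX (logn_prime p pN) ltnS (leq_eqVlt p).
have [->|pN'] := eqVneq p N; last by rewrite muln0 addn0.
rewrite ltnn andbF => _; rewrite -leqn0 leqNgt logn_gt0 mem_primes.
by rewrite pN m0 /= -prime_coprime.
Qed.

Lemma uniq_euler_list (Q : pred nat) (S : seq nat) (N : nat) :
  (forall q, Q q -> prime q) -> uniq S -> uniq (euler_list Q S N).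
Proof.
move=> Qp uS; elim: N => //= N IHN; case: ifPn => // QN.
have pN := Qp N QN; have pw e : (0 < N ^ e)%N by rewrite expn_gt0 prime_gt0.
 apply: allpairs_uniq => //.
move=> _ _ /allpairsP[[b e] [/= bL _ ->]] /allpairsP[[b' e'] [/= bL' _ ->]] /= E.
have [b0 /(_ N pN)] := (mem_euler_list S N b Qp).1 bL.
have [b'0 /(_ N pN)] := (mem_euler_list S N b' Qp).1 bL'.
rewrite ltnn andbF => /eqP l0' /eqP l0.
have ee : e = e'.
  have := congr1 (logn N) E; rewrite !lognM// l0 l0'.
  by rewrite !lognX (logn_prime _ pN) eqxx !muln1.
move/eqP: E; rewrite ee eqn_pmul2r//.
by move=> /eqP ->.
Qed.

Lemma sum_euler_list (R : comNzRingType) (Q : pred nat) (S : seq nat) (N : nat)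
    (g : nat -> R) :
  (forall q, Q q -> prime q) -> g 1%N = 1 ->
  (forall m n, (0 < m)%N -> (0 < n)%N -> g (m * n)%N = g m * g n) ->
  \sum_(n <- euler_list Q S N) g n =
  \prod_(0 <= q < N | Q q) \sum_(e <- S) g (q ^ e)%N.
Proof.
move=> Qp g1 gM; elim: N => [|N IHN] /=.
  by rewrite big_seq1 big_nil g1.
rewrite [RHS]big_mkcond big_nat_recr//= -[X in _ = X * _]big_mkcond /=.
case: ifPn => QN; last by rewrite mulr1 IHN.
have pN := Qp N QN; have pw e : (0 < N ^ e)%N by rewrite expn_gt0 prime_gt0.
rewrite big_allpairs_dep -IHN mulr_suml big_seq [RHS]big_seq.
apply: eq_bigr => b bL; rewrite mulr_sumr; apply: eq_bigr => e _.
have [b0 _] := (mem_euler_list S N b Qp).1 bL.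
by rewrite gM.
Qed.

Lemma ler_sum_subset (R : numDomainType) (T : eqType) (s1 s2 : seq T) (g : T -> R) :
  uniq s1 -> uniq s2 -> {subset s1 <= s2} -> (forall x, 0 <= g x) ->
  \sum_(x <- s1) g x <= \sum_(x <- s2) g x.
Proof.
move=> u1 u2 s12 g0; rewrite [leRHS](bigID (mem s1)) /= -[X in _ <= X + _]big_filter.
have -> : \sum_(x <- s1) g x = \sum_(x <- [seq x <- s2 | x \in s1]) g x.
  apply: perm_big; apply: uniq_perm; rewrite ?filter_uniq// => x.
  by rewrite mem_filter; have [/s12 ->|] := boolP (x \in s1).
by rewrite lerDl sumr_ge0.
Qed.

Lemma sum_count_le (R : realType) (z : R) (N : nat) : 0 <= z ->
  \sum_(0 <= a < N | (0 < a)%N && (a%:R <= z)) 1 <= z.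
Proof.
move=> z0; apply: (@le_trans _ _ (\sum_(1 <= a < (Num.truncn z).+1) 1)); last first.
  by rewrite sumr_const_nat subn1 truncn_le.
rewrite -big_filter; apply: ler_sum_subset => //; rewrite ?filter_uniq ?iota_uniq//.
move=> a; rewrite mem_filter !mem_index_iota => /andP[/andP[a0 az] _].
by rewrite a0 ltnS truncn_ge_nat.
Qed.

Lemma powR_natM (R : realType) (s : R) (m n : nat) :
  (m * n)%:R `^ s = m%:R `^ s * n%:R `^ s :> R.
Proof. by rewrite natrM powRM. Qed.

Lemma powR_natX (R : realType) (s : R) (m n : nat) :
  (m ^ n)%:R `^ s = (m%:R `^ s) ^+ n :> R.
Proof.
elim: n => [|n IHn]; first by rewrite powR1.
by rewrite expnS powR_natM IHn exprS.
Qed.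

(** * The Euler factors of [gamma0] *)

Definition hexps (h : nat) : seq nat := 0%N :: iota h.+1 h.-1.

(* The Euler factor at [q], for [s = 1/h], of the Dirichlet series of [hbase h]. *)
Definition local_factor (R : realType) (h q : nat) : R :=
  \sum_(e <- hexps h) (q ^ e)%:R `^ (- h%:R^-1).

Lemma prime_root_lt1 (R : realType) (h q : nat) : (0 < h)%N -> prime q ->
  let t := q%:R `^ (- h%:R^-1) : R in
  [/\ 0 < t, t < 1, t ^+ h = q%:R^-1 & t ^+ h.+1 = q%:R `^ (- (1 + h%:R^-1))].
Proof.
move=> h0 qp t; have q0 : 0 < q%:R :> R by rewrite ltr0n prime_gt0.
have q1 : 1 < q%:R :> R by rewrite ltr1n prime_gt1.
have hi : 0 < h%:R^-1 :> R by rewrite invr_gt0 ltr0n.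
have t0 : 0 < t by rewrite powR_gt0.
have th : t ^+ h = q%:R^-1.
  rewrite -powR_mulrn ?(ltW t0)// -powRrM mulNr mulVf ?gt_eqF ?ltr0n//.
  exact: powRV.
split=> //; last by rewrite exprSr th powRNS// mulrC.
by rewrite /t powRN invf_lt1 ?powR_gt0// /powR gt_eqF// expR_gt1 mulr_gt0// ln_gt0.
Qed.

(** The geometric sum t^(h+1) + ... + t^(2h-1) equals t^(h+1) * (1 - t^(h-1)) / (1 - t), which is
    the fraction on the right in terms of t. *)
Lemma local_factorE (R : realType) (h q : nat) : (0 < h)%N -> prime q ->
  local_factor R h q =
  1 + (q%:R - q%:R `^ h%:R^-1) / (q%:R ^+ 2 * (q%:R `^ h%:R^-1 - 1)).
Proof.
move=> h0 qp; have [] := prime_root_lt1 R h0 qp; rewrite /local_factor /hexps big_cons.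
under eq_bigr do rewrite powR_natX.
rewrite expn0 powR1; set t := _ `^ (- _) => t0 t1 th _.
have -> : q%:R `^ h%:R^-1 = t^-1 :> R by rewrite /t powRN invrK.
have -> : q%:R = (t ^+ h)^-1 :> R by rewrite th invrK.
rewrite -[h.+1]addn0 iotaDl big_map.
have -> : \sum_(j <- iota 0 h.-1) t ^+ (h.+1 + j) = t ^+ h.+1 * \sum_(0 <= j < h.-1) t ^+ j.
  by rewrite mulr_sumr /index_iota subn0; apply: eq_bigr => j _; rewrite exprD.
have := subrX1 t h.-1; rewrite big_mkord => E; congr (_ + _).
have -> : \sum_(i < h.-1) t ^+ i = (1 - t ^+ h.-1) / (1 - t).
  by rewrite -opprB E; field; lra.
have -> : t ^+ h.+1 = t ^+ h * t by rewrite exprSr.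
have -> : t ^+ h = t ^+ h.-1 * t by rewrite -exprSr prednK.
have u0 : t ^+ h.-1 != 0 by rewrite expf_neq0// gt_eqF.
set u := t ^+ h.-1 in u0 *; field.
by rewrite u0 gt_eqF// mulN1r subr_eq0 gt_eqF.
Qed.

Lemma local_factor_ge1 (R : realType) (h q : nat) : 1 <= local_factor R h q.
Proof.
by rewrite /local_factor /hexps big_cons expn0 powR1 lerDl sumr_ge0.
Qed.

Lemma local_factor_le (R : realType) (h q : nat) : (0 < h)%N -> prime q ->
  local_factor R h q <= 1 + h%:R * q%:R `^ (- (1 + h%:R^-1)).
Proof.
move=> h0 qp; have [] := prime_root_lt1 R h0 qp; rewrite /local_factor /hexps big_cons.
under eq_bigr do rewrite powR_natX.
rewrite expn0 powR1; set t := _ `^ (- _) => t0 t1 _ th; rewrite lerD2l -th.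
apply: (@le_trans _ _ (\sum_(e <- iota h.+1 h.-1) t ^+ h.+1)).
  rewrite big_seq [leRHS]big_seq; apply: ler_sum => e; rewrite mem_iota => /andP[he _].
  by rewrite ler_wiXn2l// ltW.
rewrite big_const_seq count_predT size_iota iter_addr_0 -[leLHS]mulr_natl.
by rewrite ler_wpM2r ?exprn_ge0 ?(ltW t0)// ler_nat leq_pred.
Qed.

Lemma prod_local_factor_bounded (R : realType) (h : nat) : (0 < h)%N ->
  exists C : R, forall N, \prod_(0 <= q < N | prime q) local_factor R h q <= C.
Proof.
move=> h0; have hi : 0 < h%:R^-1 :> R by rewrite invr_gt0 ltr0n.
have [K K0 HK] := sum_powR_tail hi.
(* The cutoff 1/2 lies below every prime, so that the tail bound covers the whole sum over
   primes. *)
exists (expR (h%:R * (K * 2^-1 `^ (- h%:R^-1)))) => N.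
apply: (@le_trans _ _
  (\prod_(0 <= q < N | prime q) expR (h%:R * q%:R `^ (- (1 + h%:R^-1))))).
  apply: ler_prod => q qp; rewrite (le_trans ler01 (local_factor_ge1 _ _ _)) /=.
  by apply: le_trans (local_factor_le _ h0 qp) (expR_ge1Dx _).
rewrite -expR_sum ler_expR -mulr_sumr ler_wpM2l//.
apply: le_trans (HK _ N _) => //; rewrite -big_filter -[leRHS]big_filter.
apply: ler_sum_subset; rewrite ?filter_uniq ?iota_uniq// => q.
rewrite !mem_filter => /andP[qp ->]; rewrite andbT.
have q1 : 1 < q%:R :> R by rewrite ltr1n prime_gt1.
lra.
Qed.

Lemma gamma0E (R : realType) (h : nat) : (0 < h)%N ->
  gamma0 R h = limn (fun N => \prod_(0 <= q < N | prime q) local_factor R h q).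
Proof.
move=> h0; rewrite /gamma0; congr (limn _); apply/funext => N.
by apply: eq_bigr => q qp; rewrite local_factorE.
Qed.

Lemma prod_local_factor_nd (R : realType) (h : nat) :
  nondecreasing_seq (fun N => \prod_(0 <= q < N | prime q) local_factor R h q).
Proof.
apply/nondecreasing_seqP => N; rewrite [leRHS]big_mkcond big_nat_recr//=.
rewrite -[X in _ <= X * _]big_mkcond /=; case: ifP => _; last by rewrite mulr1.
rewrite ler_peMr ?local_factor_ge1// prodr_ge0// => q _.
exact: le_trans (local_factor_ge1 _ _ _).
Qed.

Lemma cvg_prod_local_factor (R : realType) (h : nat) : (0 < h)%N ->
  cvgn (fun N => \prod_(0 <= q < N | prime q) local_factor R h q).
Proof.
move=> h0; have [C HC] := prod_local_factor_bounded R h0.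
apply: nondecreasing_is_cvgn; first exact: prod_local_factor_nd.
by exists C => _ [N _ <-].
Qed.

Lemma prod_local_factor_le_gamma0 (R : realType) (h N : nat) : (0 < h)%N ->
  \prod_(0 <= q < N | prime q) local_factor R h q <= gamma0 R h.
Proof.
move=> h0; rewrite gamma0E//; apply: (limn_ge_from (n0 := N)).
  exact: cvg_prod_local_factor.
by move=> m; apply: prod_local_factor_nd.
Qed.

Lemma uniq_hexps (h : nat) : uniq (hexps h).
Proof. by rewrite /hexps /= iota_uniq mem_iota andbT. Qed.

Lemma mem_hexps (h e : nat) : (0 < h)%N ->
  e \in hexps h <-> e = 0%N \/ (h < e < h.*2)%N.
Proof.
move=> h0; rewrite inE mem_iota; have -> : (h.+1 + h.-1 = h.*2)%N by lia.
by split=> [/orP[/eqP ->|->]|[->|->]]; rewrite ?orbT; [left|right|..].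
Qed.

Definition coprime_primes (p q : nat) : bool := prime q && (q != p).

Lemma prod_split_prime (R : realType) (h p N : nat) : prime p -> (p < N)%N ->
  \prod_(0 <= q < N | prime q) local_factor R h q =
  local_factor R h p * \prod_(0 <= q < N | coprime_primes p q) local_factor R h q.
Proof.
move=> pp pN; rewrite -big_filter (bigD1_seq p) /=; first by rewrite big_filter_cond.
  by rewrite mem_filter mem_index_iota pp.
by rewrite filter_uniq// iota_uniq.
Qed.

(** [Q] will be either all primes or all primes but one. The converse comparison is
    [prod_le_sum_hbase]. *)
Lemma sum_hbase_le_prod (R : realType) (h N M : nat) (Q : pred nat) : (0 < h)%N ->
  (forall q, Q q -> prime q) -> (N <= M)%N ->
  \sum_(0 <= b < N | hbase h b && all Q (primes b)) b%:R `^ (- h%:R^-1) <=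
  \prod_(0 <= q < M | Q q) local_factor R h q.
Proof.
move=> h0 Qp NM; rewrite -(@sum_euler_list _ _ _ _ (fun b => b%:R `^ (- h%:R^-1)))//.
- rewrite -big_filter; apply: ler_sum_subset.
  + by rewrite filter_uniq// iota_uniq.
  + by rewrite uniq_euler_list// uniq_hexps.
  + move=> b; rewrite mem_filter mem_index_iota => /andP[/andP[/hbaseP[b0 Hb] /allP bQ] bN].
    apply/mem_euler_list => //; split=> // p pp; case: ifPn => [_|].
      exact/mem_hexps/Hb.
    apply: contraR; rewrite -lt0n logn_gt0 => pb; rewrite (bQ _ pb) /=.
    move: pb; rewrite mem_primes => /and3P[_ _ /(dvdn_leq b0)] pb.
    exact: leq_ltn_trans pb (leq_trans bN NM).
  + by move=> x; exact: powR_ge0.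
- by rewrite powR1.
- by move=> m n _ _; exact: powR_natM.
Qed.

Lemma prod_le_sum_hbase (R : realType) (h N : nat) (Q : pred nat) : (0 < h)%N ->
  (forall q, Q q -> prime q) ->
  exists M, \prod_(0 <= q < N | Q q) local_factor R h q <=
    \sum_(0 <= b < M | hbase h b && all Q (primes b)) b%:R `^ (- h%:R^-1).
Proof.
(* The sum of the list is a crude bound for each of its members. *)
move=> h0 Qp; exists (\sum_(b <- euler_list Q (hexps h) N) b).+1%N.
rewrite -(@sum_euler_list _ _ _ _ (fun b => b%:R `^ (- h%:R^-1)))//.
- rewrite -[leRHS]big_filter; apply: ler_sum_subset.
  + by rewrite uniq_euler_list// uniq_hexps.
  + by rewrite filter_uniq// iota_uniq.
  + move=> b bL; rewrite mem_filter mem_index_iota /= ltnS.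
    have [b0 Hb] := (mem_euler_list (hexps h) N b Qp).1 bL.
    apply/andP; split; last by rewrite (big_rem b)//= leq_addr.
    apply/andP; split.
      apply/hbaseP; split=> // p pp; have := Hb p pp.
      by case: ifP => _; [move/(mem_hexps _ h0)|move/eqP; left].
    apply/allP => p; rewrite -logn_gt0 => pb.
    have pp : prime p by move: pb; rewrite logn_gt0 mem_primes => /andP[].
    have := Hb p pp; case: (Q p) => //= /eqP pb0.
    by rewrite pb0 in pb.
  + by move=> x; exact: powR_ge0.
- by rewrite powR1.
- by move=> m n _ _; exact: powR_natM.
Qed.

(** * Number and tails of h-full numbers *)

Lemma sum_hbase_bounded (R : realType) (h : nat) : (0 < h)%N ->
  exists2 C : R, 0 <= C &
    forall N, \sum_(0 <= b < N | hbase h b) b%:R `^ (- h%:R^-1) <= C.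
Proof.
move=> h0; have [C HC] := prod_local_factor_bounded R h0; exists C.
  by apply: le_trans (HC 0%N); rewrite big_nil.
move=> N; apply: le_trans (HC N).
apply: le_trans (sum_hbase_le_prod R h0 (fun _ => id) (leqnn N)).
rewrite le_eqVlt; apply/orP; left; apply/eqP; apply: eq_bigl => b.
case: (hbase h b) => //=; apply/esym/allP => p.
by rewrite mem_primes => /andP[].
Qed.

(** Each [b] admits at most (y/b)^(1/h) values of [a], and the sum of b^(-1/h) is bounded. It is
    applied with [h.+1], to count the [b] themselves: by [hbase_h_full] they are [h.+1]-full. *)
Lemma count_h_full (R : realType) (h : nat) : (0 < h)%N ->
  exists2 C : R, 0 <= C & forall (y : R) N, 0 <= y ->
    \sum_(0 <= n < N | h_full h n && (n%:R <= y)) 1 <= C * y `^ h%:R^-1.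
Proof.
move=> h0; have [C C0 HC] := sum_hbase_bounded R h0; exists C => // y N y0.
rewrite big_mkcondr /= sum_h_full//.
apply: (@le_trans _ _ (\sum_(0 <= b < N | hbase h b) (y `^ h%:R^-1 * b%:R `^ (- h%:R^-1)))).
  apply: ler_sum => b hb; have b0 : 0 < b%:R :> R by rewrite ltr0n (hbase_gt0 hb).
  have -> : y `^ h%:R^-1 * b%:R `^ (- h%:R^-1) = (y / b%:R) `^ h%:R^-1.
    by rewrite powRM ?invr_ge0 ?(ltW b0)// powR_invl.
  rewrite -big_mkcondr /=.
  apply: le_trans (sum_count_le N (powR_ge0 (y / b%:R) h%:R^-1)).
  rewrite -big_filter -[leRHS]big_filter; apply: ler_sum_subset => //.
  - by rewrite filter_uniq// iota_uniq.
  - by rewrite filter_uniq// iota_uniq.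
  move=> a; rewrite !mem_filter => /andP[/andP[/andP[a0 _] aby] ->]; rewrite a0 andbT /=.
  have h1 : 0 < h%:R :> R by rewrite ltr0n.
  have -> : a%:R = (a%:R ^+ h) `^ h%:R^-1 :> R.
    by rewrite -powR_mulrn// -powRrM divff ?gt_eqF// powRr1.
  apply: ge0_ler_powR; rewrite ?nnegrE ?invr_ge0 ?exprn_ge0 ?divr_ge0 ?(ltW b0) ?(ltW h1)//.
  by rewrite ler_pdivlMr// -natrX -natrM.
by rewrite -mulr_sumr mulrC ler_wpM2r ?powR_ge0.
Qed.

(** For n = a^(h+1) * b, the condition y < n reads a > z with z = (y/b)^(1/(h+1)), and n^(-1/h) is
    b^(-1/h) * a^(-1-1/h). The tail over [a] is O(z^(-1/h)), which leaves the convergent sum of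
    b^(-1/(h+1)) and the power of y with exponent -1/(h(h+1)). *)
Lemma tail_h_full (R : realType) (h : nat) : (0 < h)%N ->
  exists2 C : R, 0 <= C & forall (y : R) N, 0 < y ->
    \sum_(0 <= n < N | h_full h.+1 n && (y < n%:R)) n%:R `^ (- h%:R^-1)
    <= C * y `^ (h.+1%:R^-1 - h%:R^-1).
Proof.
move=> h0; have [C C0 HC] := sum_hbase_bounded R (ltn0Sn h).
have hi : 0 < h%:R^-1 :> R by rewrite invr_gt0 ltr0n.
have [K K0 HK] := sum_powR_tail hi.
exists (K * C) => [|y N y0]; first by rewrite mulr_ge0// ltW.
set e := h.+1%:R^-1 - h%:R^-1.
rewrite big_mkcondr /= sum_h_full//.
apply: (@le_trans _ _ (\sum_(0 <= b < N | hbase h.+1 b)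
    (K * y `^ e * b%:R `^ (- h.+1%:R^-1)))); last first.
  rewrite -mulr_sumr -!mulrA [y `^ _ * _]mulrC !mulrA ler_wpM2r ?powR_ge0//.
  by rewrite ler_wpM2l ?(ltW K0).
apply: ler_sum => b hb; have b0 : 0 < b%:R :> R by rewrite ltr0n (hbase_gt0 hb).
rewrite -big_mkcondr /=; set z := (y / b%:R) `^ h.+1%:R^-1.
have z0 : 0 < z by rewrite powR_gt0// divr_gt0.
have h1 : 0 < h%:R :> R by rewrite ltr0n.
have hS : 0 < h.+1%:R :> R by rewrite ltr0n.
have eE : e = - (h.+1%:R^-1 * h%:R^-1).
  by rewrite /e -natr1; field; rewrite natr1 !gt_eqF.
have -> : K * y `^ e * b%:R `^ (- h.+1%:R^-1) =
    b%:R `^ (- h%:R^-1) * (K * z `^ (- h%:R^-1)).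
  rewrite /z -powRrM mulrN -eE powRM ?invr_ge0 ?(ltW b0) ?(ltW y0)//.
  rewrite powR_invl//.
  have -> : b%:R `^ (- h.+1%:R^-1) = b%:R `^ (- h%:R^-1) * b%:R `^ (- e).
    rewrite -powRD; last by rewrite (gt_eqF b0) implybT.
    by congr (_ `^ _); rewrite /e; ring.
  by ring.
apply: le_trans (_ : b%:R `^ (- h%:R^-1) *
  \sum_(0 <= a < N | z < a%:R) a%:R `^ (- (1 + h%:R^-1)) <= _); last first.
  by rewrite ler_wpM2l ?powR_ge0// HK.
rewrite mulr_sumr.
have aE a : (0 < a)%N -> (a ^ h.+1 * b)%:R `^ (- h%:R^-1) =
    b%:R `^ (- h%:R^-1) * a%:R `^ (- (1 + h%:R^-1)) :> R.
  move=> a0; rewrite powR_natM mulrC; congr (_ * _).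
  rewrite natrX -powR_mulrn// -powRrM; congr (_ `^ _).
  by rewrite -natr1; field; rewrite gt_eqF.
rewrite (eq_bigr (fun a => b%:R `^ (- h%:R^-1) * a%:R `^ (- (1 + h%:R^-1)))); last first.
  by move=> a /andP[/andP[a0 _] _]; rewrite aE.
rewrite -big_filter -[leRHS]big_filter; apply: ler_sum_subset.
- by rewrite filter_uniq// iota_uniq.
- by rewrite filter_uniq// iota_uniq.
- move=> a; rewrite !mem_filter => /andP[/andP[/andP[a0 _] yab] ->]; rewrite andbT.
  have -> : a%:R = (a%:R ^+ h.+1) `^ h.+1%:R^-1 :> R.
    by rewrite -powR_mulrn// -powRrM divff ?gt_eqF// powRr1.
  apply: gt0_ltr_powR; rewrite ?invr_gt0// ?nnegrE ?exprn_ge0 ?divr_ge0 ?(ltW b0) ?(ltW y0)//.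
  by rewrite ltr_pdivrMr// -natrX -natrM.
- by move=> a; rewrite mulr_ge0 ?powR_ge0.
Qed.

(** * Counting h-full numbers prime to p *)

Lemma sum_not_dvdn (R : realType) (p M : nat) : (0 < p)%N ->
  \sum_(1 <= a < M.+1 | ~~ (p %| a)%N) 1 = M%:R - (M %/ p)%:R :> R.
Proof.
move=> p0; elim: M => [|M IHM]; first by rewrite big_geq// div0n subrr.
rewrite big_mkcond big_nat_recr//= -big_mkcond IHM divnS// natrD -natr1.
by case: (p %| M.+1)%N => /=; rewrite ?mulr1n ?mulr0n; ring.
Qed.

(** Rounding [z] down and rounding z/p down give errors of opposite signs, so together they stay
    within 1, uniformly in [p]. *)
Lemma count_not_dvdn_dist (R : realType) (p : nat) (z : R) : (0 < p)%N -> 0 <= z ->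
  `|\sum_(1 <= a < (Num.truncn z).+1 | ~~ (p %| a)%N) 1 - (1 - p%:R^-1) * z| <= 1.
Proof.
move=> p0 z0; rewrite sum_not_dvdn//; have /andP[] := truncn_itv z0.
set M := Num.truncn z => Mz zM; rewrite -natr1 in zM.
have pR : 0 < p%:R :> R by rewrite ltr0n.
have qz : (M %/ p)%:R <= z / p%:R.
  by rewrite ler_pdivlMr// -natrM; apply: le_trans Mz; rewrite ler_nat leq_trunc_div.
have zq : z / p%:R <= (M %/ p)%:R + 1.
  rewrite ler_pdivrMr// natr1 -natrM; apply: (le_trans (ltW zM)).
  by rewrite natr1 ler_nat; apply: ltn_ceil.
rewrite ler_norml; apply/andP; split; lra.
Qed.

Lemma coprime_primes_prime (p q : nat) : coprime_primes p q -> prime q.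
Proof. by case/andP. Qed.

Lemma all_coprime_primes (p b : nat) : prime p -> (0 < b)%N ->
  all (coprime_primes p) (primes b) = ~~ (p %| b)%N.
Proof.
move=> pp b0; apply/allP/idP => [H|pb q].
  apply/negP => pb; have := H p; rewrite mem_primes pp b0 pb => /(_ isT).
  by rewrite /coprime_primes eqxx andbF.
rewrite mem_primes => /and3P[qp _ qb]; rewrite /coprime_primes qp /=.
by apply: contraNneq pb => <-.
Qed.

Lemma hbase_coprimeE (p h b : nat) : prime p ->
  hbase h b && all (coprime_primes p) (primes b) = hbase h b && ~~ (p %| b)%N.
Proof.
move=> pp; have [hb|//] := boolP (hbase h b).
by rewrite all_coprime_primes// (hbase_gt0 hb).
Qed.

(** Removing the factor at [p] from the Euler product gives the complete sum over [b] prime to [p].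
    What is missing beyond [y] is bounded by the tail over all [h.+1]-full numbers, hence a constant
    independent of [p]. *)
Lemma sum_hbase_coprime (R : realType) (h : nat) : (0 < h)%N ->
  exists2 C : R, 0 <= C & forall (p : nat) (y : R), prime p -> 0 < y ->
  `|\sum_(0 <= b < (Num.truncn y).+1 | hbase h b && ~~ (p %| b)%N) b%:R `^ (- h%:R^-1)
    - gamma0 R h / local_factor R h p| <= C * y `^ (h.+1%:R^-1 - h%:R^-1).
Proof.
move=> h0; have [C C0 HC] := tail_h_full R h0; exists C => // p y pp y0.
set N := (Num.truncn y).+1; have l1 := local_factor_ge1 R h p.
have l0 : 0 < local_factor R h p by lra.
set S := \sum_(_ <= b < _ | _) _.
have SE M : \sum_(0 <= b < M | hbase h b && all (coprime_primes p) (primes b))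
    b%:R `^ (- h%:R^-1) = \sum_(0 <= b < M | hbase h b && ~~ (p %| b)%N)
    b%:R `^ (- h%:R^-1) :> R.
  by apply: eq_bigl => b; exact: hbase_coprimeE.
have Sle : S <= gamma0 R h / local_factor R h p.
  rewrite ler_pdivlMr// /S -SE; pose M := maxn N p.+1.
  apply: le_trans (prod_local_factor_le_gamma0 R M h0).
  rewrite (prod_split_prime R h pp); last by rewrite leq_maxr.
  rewrite mulrC ler_wpM2l ?(ltW l0)// sum_hbase_le_prod ?leq_maxl//.
  exact: coprime_primes_prime.
have Sge : gamma0 R h / local_factor R h p <= S + C * y `^ (h.+1%:R^-1 - h%:R^-1).
  rewrite ler_pdivrMr// mulrC gamma0E//; apply: (limn_le_from (n0 := p.+1)).
    exact: cvg_prod_local_factor.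
  move=> M pM; rewrite (prod_split_prime R h pp pM) ler_wpM2l ?(ltW l0)//.
  have [M' HM'] := prod_le_sum_hbase R M h0 (@coprime_primes_prime p).
  apply: le_trans HM' _; rewrite SE.
  rewrite (bigID (fun b : nat => y < b%:R)) /= addrC; apply: lerD.
    rewrite /S -big_filter -[leRHS]big_filter; apply: ler_sum_subset.
    - by rewrite filter_uniq// iota_uniq.
    - by rewrite filter_uniq// iota_uniq.
    - move=> b; rewrite !mem_filter => /andP[/andP[-> +] _].
      by rewrite -leNgt mem_index_iota /= ltnS truncn_ge_nat ?(ltW y0).
    - by move=> b; exact: powR_ge0.
  apply: le_trans (HC y M' y0); rewrite -big_filter -[leRHS]big_filter; apply: ler_sum_subset.
  - by rewrite filter_uniq// iota_uniq.
  - by rewrite filter_uniq// iota_uniq.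
  - by move=> b; rewrite !mem_filter => /andP[/andP[/andP[/hbase_h_full -> _] ->] ->].
  - by move=> b; exact: powR_ge0.
rewrite ler_norml; apply/andP; split; first by lra.
rewrite (@le_trans _ _ 0)// ?subr_le0// mulr_ge0 ?powR_ge0//.
Qed.

Lemma h_full_countE (R : realType) (h p : nat) (y : R) : (0 < h)%N -> prime p -> 0 < y ->
  h_full_count h p y =
  \sum_(0 <= b < (Num.truncn y).+1 | hbase h b && ~~ (p %| b)%N)
    \sum_(1 <= a < (Num.truncn ((y / b%:R) `^ h%:R^-1)).+1 | ~~ (p %| a)%N) 1.
Proof.
move=> h0 pp y0; rewrite /h_full_count big_mkcondr sum_h_full//= [RHS]big_mkcondr /=.
set N := (Num.truncn y).+1; apply: eq_bigr => b hb.
have b0 : 0 < b%:R :> R by rewrite ltr0n (hbase_gt0 hb).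
have hR : 0 < h%:R :> R by rewrite ltr0n.
rewrite -big_mkcondr /=.
have pE a : (p %| a ^ h * b)%N = (p %| a)%N || (p %| b)%N.
  by rewrite Euclid_dvdM// Euclid_dvdX// h0 andbT.
case: ifPn => pb; last first.
  by apply: big1 => a; rewrite pE (negbNE pb) orbT andbF.
rewrite -big_filter -[RHS]big_filter; apply: perm_big; apply: uniq_perm.
- by rewrite filter_uniq// iota_uniq.
- by rewrite filter_uniq// iota_uniq.
move=> a; rewrite !mem_filter !mem_index_iota pE (negbTE pb) orbF /=.
rewrite andbC -!andbA [RHS]andbC -!andbA; case: (~~ (p %| a)%N); rewrite ?andbF// !andbT.
have [a0|] /= := boolP (0 < a)%N; last by rewrite andbF.
have aN : (a <= a ^ h * b)%N.
  apply: (@leq_trans (a ^ h)%N); last by rewrite leq_pmulr// (hbase_gt0 hb).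
  by rewrite -{1}(expn1 a) leq_pexp2l.
rewrite /N !ltnS.
have -> : ((a <= Num.truncn y) && (a ^ h * b <= Num.truncn y))%N = (a ^ h * b <= Num.truncn y)%N.
  by case: (leqP (a ^ h * b)) => H; rewrite ?andbF// andbT (leq_trans aN H).
rewrite !truncn_ge_nat ?powR_ge0 ?(ltW y0)// natrM natrX -ler_pdivlMr//.
have aE : a%:R = (a%:R ^+ h) `^ h%:R^-1 :> R.
  by rewrite -powR_mulrn// -powRrM divff ?gt_eqF// powRr1.
rewrite [in RHS]aE; apply/idP/idP => H.
  by apply: ge0_ler_powR;
    rewrite ?nnegrE ?invr_ge0 ?exprn_ge0 ?divr_ge0 ?(ltW b0) ?(ltW y0) ?(ltW hR).
rewrite leNgt; apply/negP => H'; move: H; rewrite leNgt => /negP; apply.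
by apply: gt0_ltr_powR; rewrite ?invr_gt0// ?nnegrE ?exprn_ge0 ?divr_ge0 ?(ltW b0) ?(ltW y0).
Qed.

(* The relative density, among [h]-full numbers, of those prime to [p]. *)
Definition coprime_density (R : realType) (h p : nat) : R :=
  (1 - p%:R^-1) / local_factor R h p.

Lemma h_full_count_dist (R : realType) (h : nat) : (0 < h)%N ->
  exists2 C : R, 0 <= C & forall (p : nat) (y : R), prime p -> 0 < y ->
  `|h_full_count h p y - gamma0 R h * coprime_density R h p * y `^ h%:R^-1|
    <= C * y `^ h.+1%:R^-1.
Proof.
move=> h0; have [C1 C10 H1] := count_h_full R (ltn0Sn h).
have [C2 C20 H2] := sum_hbase_coprime R h0.
exists (C1 + C2) => [|p y pp y0]; first exact: addr_ge0.
rewrite h_full_countE//; set N := (Num.truncn y).+1.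
have pR : 1 < p%:R :> R by rewrite ltr1n prime_gt1.
have pi0 : 0 < p%:R^-1 :> R by rewrite invr_gt0; lra.
have pi1 : p%:R^-1 < 1 :> R by rewrite invf_lt1; lra.
have := H2 p y pp y0; rewrite -/N; set S := \sum_(_ <= b < _ | _) _ => HS.
have yh0 := powR_ge0 y h%:R^-1.
(* A rounding error of at most 1 for each [b], and these [b] are [h.+1]-full numbers up to [y]. *)
have e1 : `|\sum_(0 <= b < N | hbase h b && ~~ (p %| b)%N)
    \sum_(1 <= a < (Num.truncn ((y / b%:R) `^ h%:R^-1)).+1 | ~~ (p %| a)%N) 1
    - (1 - p%:R^-1) * y `^ h%:R^-1 * S| <= C1 * y `^ h.+1%:R^-1.
  rewrite /S mulr_sumr -sumrB; apply: le_trans (ler_norm_sum _ _ _) _.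
  apply: (@le_trans _ _ (\sum_(0 <= b < N | hbase h b && ~~ (p %| b)%N) 1)).
    apply: ler_sum => b /andP[hb _].
    have b0 : 0 < b%:R :> R by rewrite ltr0n (hbase_gt0 hb).
    have -> : (1 - p%:R^-1) * y `^ h%:R^-1 * b%:R `^ (- h%:R^-1) =
       (1 - p%:R^-1) * (y / b%:R) `^ h%:R^-1.
      by rewrite powRM ?invr_ge0 ?(ltW b0) ?(ltW y0)// powR_invl// mulrA.
    by apply: count_not_dvdn_dist; rewrite ?prime_gt0 ?powR_ge0.
  apply: le_trans (H1 y N (ltW y0)); rewrite -big_filter -[leRHS]big_filter.
  apply: ler_sum_subset => //; rewrite ?filter_uniq ?iota_uniq// => b.
  rewrite !mem_filter => /andP[/andP[/hbase_h_full -> _]]; rewrite mem_index_iota => /andP[_ bN].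
  by rewrite bN /= andbT -truncn_ge_nat ?(ltW y0)// -ltnS.
(* The cost of truncating the sum over [b] at [y]. *)
have e2 : `|(1 - p%:R^-1) * y `^ h%:R^-1 * S
    - gamma0 R h * coprime_density R h p * y `^ h%:R^-1| <= C2 * y `^ h.+1%:R^-1.
  have -> : (1 - p%:R^-1) * y `^ h%:R^-1 * S
    - gamma0 R h * coprime_density R h p * y `^ h%:R^-1 =
    (1 - p%:R^-1) * y `^ h%:R^-1 * (S - gamma0 R h / local_factor R h p).
    by rewrite /coprime_density; ring.
  have -> : C2 * y `^ h.+1%:R^-1 = y `^ h%:R^-1 * (C2 * y `^ (h.+1%:R^-1 - h%:R^-1)).
    rewrite mulrCA -powRD; last by rewrite (gt_eqF y0) implybT.
    by congr (_ * _ `^ _); ring.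
  rewrite normrM ger0_norm; last by rewrite mulr_ge0//; lra.
  apply: ler_pM => //; first by rewrite mulr_ge0//; lra.
  by rewrite ler_piMl//; lra.
rewrite mulrDl; apply: le_trans (lerD e1 e2).
by apply: le_trans (ler_normD _ _); rewrite addrA subrK.
Qed.

(** * Estimates of Chebyshev and Mertens *)

Lemma prod_primes_dvdn (s : seq nat) (n : nat) :
  uniq s -> (forall p, p \in s -> prime p && (p %| n)%N) ->
  (\prod_(p <- s) p %| n)%N.
Proof.
elim: s n => [|p s IHs] n /=; first by rewrite big_nil dvd1n.
move=> /andP[ps us] H; rewrite big_cons.
have /andP[pp /dvdnP[m nE]] : prime p && (p %| n)%N by rewrite H// mem_head.
rewrite nE (mulnC m) dvdn_mul//; apply: IHs => // q qs.
have /andP[qp] : prime q && (q %| n)%N by rewrite H// inE qs orbT.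
rewrite nE Euclid_dvdM// qp (dvdn_prime2 qp pp) => /orP[->//|/eqP qE].
by move: ps; rewrite -qE qs.
Qed.

(** Erdos' argument: the primes from m+2 to 2m+1 divide the binomial coefficient of 2m+1 over m,
    which is at most 4^m because it occurs twice in the expansion of (1+1)^(2m+1). The other primes
    up to 2m+1 are covered by induction. *)
Lemma primorial_le (n : nat) : (\prod_(0 <= p < n.+1 | prime p) p <= 4 ^ n)%N.
Proof.
elim/ltn_ind: n => -[|[|n]] IHn.
- by rewrite big_mkcond !big_nat_recr//= big_nil.
- by rewrite big_mkcond !big_nat_recr//= big_nil.
have step : ~~ prime n.+2 -> (\prod_(0 <= p < n.+3 | prime p) p <= 4 ^ n.+2)%N.
  move=> np; rewrite big_mkcond big_nat_recr//= (negbTE np) muln1 -big_mkcond.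
  by apply: leq_trans (IHn n.+1 _) _; rewrite // leq_exp2l.
have [|] := boolP (prime n.+2); last exact: step.
move=> np; have [n0|n0] := posnP n.
  by rewrite n0 big_mkcond !big_nat_recr//= big_nil.
have on : odd n by have /even_prime := np => -[|/=]; [lia|rewrite !negbK].
have [m mE] : exists m, n.+2 = m.*2.+1.
  by exists (n.+2)./2; rewrite -[LHS]odd_double_half /= negbK on.
have m0 : (0 < m)%N by lia.
rewrite mE (@big_cat_nat _ _ _ m.+2)//=; last by lia.
apply: (@leq_trans (4 ^ m.+1 * 4 ^ m)); last by rewrite -expnD leq_exp2l//; lia.
apply: leq_mul; first by apply: IHn; lia.
have mm : (m <= m.*2.+1)%N by lia.
have bm : (m.*2.+1 - m = m.+1)%N by lia.
apply: (@leq_trans 'C(m.*2.+1, m)).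
  apply: dvdn_leq; first by rewrite bin_gt0.
  rewrite -big_filter; apply: prod_primes_dvdn; first by rewrite filter_uniq// iota_uniq.
  move=> p; rewrite mem_filter mem_index_iota => /andP[pp /andP[mp pm]]; rewrite pp /=.
  have : (p %| (m.*2.+1)`!)%N by rewrite dvdn_fact// prime_gt0//; lia.
  have nf k : (k < p)%N -> ~~ (p %| k`!)%N.
    elim: k => [|k IHk] kp; first by rewrite fact0 dvdn1; case: eqP pp => // ->.
    by rewrite factS Euclid_dvdM// negb_or IHk ?andbT ?(ltnW kp)// gtnNdvd.
  have mp' : (m < p)%N by lia.
  rewrite -(bin_fact mm) bm Euclid_dvdM// Euclid_dvdM//.
  by rewrite (negbTE (nf _ mp)) (negbTE (nf _ mp')) !orbF.
have -> : (4 ^ m = 2 ^ m.*2)%N by rewrite -mul2n expnM.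
rewrite -(leq_pmul2l (isT : 0 < 2)%N) -expnS.
have -> : (2 ^ m.*2.+1 = \sum_(i < m.*2.+2) 'C(m.*2.+1, i))%N.
  rewrite -[in LHS](addn1 1) expnDn; apply: eq_bigr => i _.
  by rewrite !exp1n !muln1.
have i1 : (m < m.*2.+2)%N by lia.
have i2 : (m.+1 < m.*2.+2)%N by lia.
rewrite (bigD1 (Ordinal i1))//= (bigD1 (Ordinal i2))/=; last first.
  by rewrite -val_eqE /=; lia.
have -> : 'C(m.*2.+1, m.+1) = 'C(m.*2.+1, m) by rewrite -[RHS]bin_sub// bm.
by rewrite addnA addnn mul2n leq_addr.
Qed.

Lemma ln_prod (R : realType) (I : Type) (r : seq I) (P : pred I) (F : I -> R) :
  (forall i, P i -> 0 < F i) ->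
  ln (\prod_(i <- r | P i) F i) = \sum_(i <- r | P i) ln (F i).
Proof.
move=> F0; elim: r => [|i r IHr]; first by rewrite !big_nil ln1.
rewrite !big_cons; case: ifPn => // Pi; rewrite lnM ?IHr// posrE ?F0//.
exact: prodr_gt0.
Qed.

Lemma chebyshev_theta (R : realType) (n : nat) :
  \sum_(0 <= p < n.+1 | prime p) ln p%:R <= n%:R * ln 4 :> R.
Proof.
rewrite -ln_prod; last by move=> p pp; rewrite ltr0n prime_gt0.
rewrite mulr_natl -lnXn// -natrX -natr_prod ler_ln ?posrE ?ltr0n.
- by rewrite ler_nat primorial_le.
- by rewrite big_seq_cond prodn_cond_gt0// => p /andP[_ /prime_gt0].
- by rewrite expn_gt0.
Qed.

Lemma ln_natS_sub (R : realType) (n : nat) : (0 < n)%N ->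
  n.+1%:R^-1 <= ln (n.+1%:R : R) - ln n%:R <= n%:R^-1.
Proof.
move=> n0; have nR : 0 < n%:R :> R by rewrite ltr0n.
have sR : 0 < n.+1%:R :> R by rewrite ltr0n.
rewrite -ln_div ?posrE//; apply/andP; split.
  apply: le_trans (ln_ge_1subV (divr_gt0 sR nR)); rewrite invf_div.
  rewrite le_eqVlt; apply/orP; left; apply/eqP; rewrite -natr1; field.
  by rewrite natr1 gt_eqF.
apply: le_trans (ln_le_subr1 (divr_gt0 sR nR)) _.
by rewrite -natr1 mulrDl divff ?gt_eqF//; lra.
Qed.

Lemma ln_fact_ge (R : realType) (n : nat) : n%:R * ln n%:R - n%:R <= ln n`!%:R :> R.
Proof.
elim: n => [|n IHn]; first by rewrite mul0r subr0 ln1.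
rewrite factS natrM lnM ?posrE ?ltr0n ?fact_gt0//.
have [->|n0] := posnP n; first by rewrite ln1 mulr0; lra.
have /andP[_] := @ln_natS_sub R _ n0; have nR : 0 < n%:R :> R by rewrite ltr0n.
rewrite -(ler_pM2l nR) divff ?gt_eqF// => H.
rewrite -[X in X * _ - X]natr1; lra.
Qed.

Lemma ln_fact_le (R : realType) (n : nat) : ln n`!%:R <= n%:R * ln n%:R :> R.
Proof.
have [->|n0] := posnP n; first by rewrite mul0r ln1.
rewrite mulr_natl -lnXn ?ltr0n// -natrX ler_ln ?posrE ?ltr0n ?fact_gt0 ?expn_gt0 ?n0//.
rewrite ler_nat; elim: n {n0} => // n IHn.
rewrite factS expnS leq_mul2l /=; apply: leq_trans IHn _.
by case: n => // n; rewrite leq_exp2r.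
Qed.

Lemma ln_fact_primes (R : realType) (n : nat) :
  ln n`!%:R = \sum_(0 <= p < n.+1 | prime p) (logn p n`!)%:R * ln p%:R :> R.
Proof.
have nE : n`! = (\prod_(p <- [seq p <- index_iota 0 n.+1 | prime p]) p ^ logn p n`!)%N.
  have ap : all prime [seq p <- index_iota 0 n.+1 | prime p] by exact: filter_all.
  apply: eqn_from_log; rewrite ?fact_gt0 ?prod_primes_gt0// => p.
  rewrite logn_prod_primes ?filter_uniq ?iota_uniq//.
  rewrite mem_filter mem_index_iota /= ltnS; case: ifPn => //.
  rewrite negb_and -ltnNge => /orP[np|np]; first by rewrite lognE (negbTE np).
  have [pp|npp] := boolP (prime p); last by rewrite lognE (negbTE npp).
  rewrite logn_fact//; apply: big1_seq => k /=; rewrite mem_index_iota => /andP[k0 _].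
  rewrite divn_small// (leq_trans np)//.
  by have := leq_pexp2l (prime_gt0 pp) k0; rewrite expn1.
rewrite {1}nE natr_prod big_filter ln_prod => [|p pp]; last first.
  by rewrite ltr0n expn_gt0 (prime_gt0 pp).
by apply: eq_bigr => p pp; rewrite natrX lnXn ?ltr0n ?prime_gt0// mulr_natl.
Qed.

Lemma logn_fact_ge (n p : nat) : prime p -> (n %/ p <= logn p n`!)%N.
Proof.
move=> pp; rewrite logn_fact//; case: n => [|n]; first by rewrite div0n.
by rewrite big_ltn// expn1 leq_addr.
Qed.

Lemma logn_fact_le (R : realType) (n p : nat) : prime p ->
  (logn p n`!)%:R <= n%:R / (p%:R - 1) :> R.
Proof.
move=> pp; have p1 : 1 < p%:R :> R by rewrite ltr1n prime_gt1.
rewrite logn_fact// natr_sum.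
apply: (@le_trans _ _ (\sum_(1 <= k < n.+1) n%:R * p%:R^-1 ^+ k)).
  apply: ler_sum => k _; rewrite exprVn ler_pdivlMr ?exprn_gt0//; last by lra.
  by rewrite -natrX -natrM ler_nat leq_trunc_div.
rewrite -mulr_sumr ler_wpM2l// big_add1 /=.
under eq_bigr do rewrite exprS.
rewrite -mulr_sumr big_mkord; have := subrX1 (p%:R^-1 : R) n.
set S := \sum_(i < n) _ => E.
have t0 : 0 < p%:R^-1 :> R by rewrite invr_gt0; lra.
have tE : p%:R = (p%:R^-1)^-1 :> R by rewrite invrK.
have t1 : p%:R^-1 < 1 :> R by rewrite invf_lt1; lra.
rewrite [leRHS](_ : _ = p%:R^-1 / (1 - p%:R^-1)); last first.
  by rewrite {1}tE; field; rewrite ?gt_eqF//; lra.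
rewrite ler_wpM2l ?(ltW t0)// -div1r ler_pdivlMr ?subr_gt0//.
have : 0 <= p%:R^-1 ^+ n :> R by rewrite exprn_ge0 ?(ltW t0).
lra.
Qed.

Lemma ln_le_sqrt (R : realType) (x : R) : 0 < x -> ln x <= 2 * x `^ 2^-1.
Proof.
move=> x0; have := ln_sublinear (powR_gt0 2^-1 x0); rewrite ln_powR; lra.
Qed.

(** The weight 1/(p(p-1)) is the gap between 1/(p-1), which bounds the exponents in n!, and 1/p. The
    same sum later controls how the logarithm of the Euler product of zeta varies with [e]. As ln p
    <= 2 sqrt p, it is dominated by the sum of 4 p^(-3/2). *)
Lemma sum_ln_prime_bounded (R : realType) : exists2 K : R, 0 < K & forall N : nat,
  \sum_(0 <= p < N | prime p) ln p%:R / (p%:R * (p%:R - 1)) <= K.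
Proof.
have s0 : 0 < 2^-1 :> R by lra.
have [K K0 HK] := sum_powR_tail s0.
exists (4 * (K * 1 `^ (- 2^-1))) => [|N]; first by rewrite mulr_gt0 ?mulr_gt0 ?powR_gt0.
apply: (@le_trans _ _ (\sum_(0 <= p < N | prime p) 4 * p%:R `^ (- (1 + 2^-1)))).
  apply: ler_sum => p pp; have p2 : 2 <= p%:R :> R by rewrite ler_nat prime_gt1.
  have p0 : 0 < p%:R :> R by lra.
  rewrite ler_pdivrMr; last by rewrite mulr_gt0//; lra.
  apply: le_trans (ln_le_sqrt p0) _.
  have -> : p%:R `^ (- (1 + 2^-1)) = p%:R `^ 2^-1 / p%:R ^+ 2 :> R.
    rewrite -powR_mulrn ?(ltW p0)// -powRB; last by rewrite (gt_eqF p0) implybT.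
    by congr (_ `^ _); lra.
  set t := _ `^ _; have t0 : 0 < t by rewrite powR_gt0.
  rewrite (_ : 4 * _ * _ = t * (4 * (1 - p%:R^-1))); last by field; lra.
  rewrite mulrC ler_wpM2l ?(ltW t0)//.
  have : p%:R^-1 <= 2^-1 :> R by rewrite lef_pV2 ?posrE.
  lra.
rewrite -mulr_sumr ler_wpM2l//; apply: le_trans (HK 1 N _) => //.
rewrite -big_filter -[leRHS]big_filter; apply: ler_sum_subset.
- by rewrite filter_uniq// iota_uniq.
- by rewrite filter_uniq// iota_uniq.
- by move=> p; rewrite !mem_filter => /andP[pp ->]; rewrite ltr1n prime_gt1.
- by move=> p; exact: powR_ge0.
Qed.

Lemma mertens_first (R : realType) : exists2 C : R, 0 < C & forall n : nat, (0 < n)%N ->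
  `|\sum_(0 <= p < n.+1 | prime p) ln p%:R / p%:R - ln n%:R| <= C.
Proof.
have [K K0 HK] := sum_ln_prime_bounded R.
have l4 : 0 < ln 4 :> R by rewrite ln_gt0//; lra.
exists (K + 1 + ln 4) => [|n n0]; first by lra.
have nR : 0 < n%:R :> R by rewrite ltr0n.
(* Upper bound: n/p is at most the exponent of [p] in n! plus 1, and Chebyshev's bound pays for the
   1. *)
have hi : n%:R * \sum_(0 <= p < n.+1 | prime p) ln p%:R / p%:R <=
    n%:R * (ln n%:R + ln 4) :> R.
  apply: (@le_trans _ _ (\sum_(0 <= p < n.+1 | prime p) (logn p n`!)%:R * ln p%:R +
     \sum_(0 <= p < n.+1 | prime p) ln p%:R)); last first.
    by rewrite -ln_fact_primes mulrDr lerD ?ln_fact_le ?chebyshev_theta.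
  rewrite -big_split mulr_sumr /=; apply: ler_sum => p pp.
  have p1 : 1 < p%:R :> R by rewrite ltr1n prime_gt1.
  have lp : 0 <= ln p%:R :> R by rewrite ln_ge0 ?ltW.
  rewrite [leLHS](_ : _ = n%:R / p%:R * ln p%:R); last by ring.
  rewrite -[X in _ <= _ + X]mul1r -mulrDl ler_wpM2r//.
  rewrite ler_pdivrMr; last by lra.
  rewrite natr1 -natrM ler_nat; apply: (@leq_trans ((n %/ p).+1 * p)).
    by rewrite ltnW// ltn_ceil// prime_gt0.
  by rewrite leq_mul2r ltnS logn_fact_ge ?orbT.
(* Lower bound: the exponent of [p] in n! is at most n/(p-1), and passing from 1/(p-1) to 1/p costs
   [K]. *)
have lo : n%:R * (ln n%:R - 1) <=
    n%:R * (\sum_(0 <= p < n.+1 | prime p) ln p%:R / p%:R + K) :> R.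
  apply: (@le_trans _ _ (ln n`!%:R)).
    by have := ln_fact_ge R n; rewrite mulrBr mulr1.
  rewrite ln_fact_primes.
  apply: (@le_trans _ _ (n%:R * (\sum_(0 <= p < n.+1 | prime p) ln p%:R / p%:R +
     \sum_(0 <= p < n.+1 | prime p) ln p%:R / (p%:R * (p%:R - 1))))); last first.
    by rewrite ler_wpM2l ?(ltW nR)// lerD2l HK.
  rewrite -big_split mulr_sumr /=; apply: ler_sum => p pp.
  have p1 : 1 < p%:R :> R by rewrite ltr1n prime_gt1.
  have lp : 0 <= ln p%:R :> R by rewrite ln_ge0 ?ltW.
  apply: (@le_trans _ _ (n%:R / (p%:R - 1) * ln p%:R)).
    by rewrite ler_wpM2r// logn_fact_le.
  by rewrite le_eqVlt; apply/orP; left; apply/eqP; field; apply/andP; split; lra.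
rewrite ler_pM2l// in hi; rewrite ler_pM2l// in lo.
by rewrite ler_norml; apply/andP; split; lra.
Qed.

(* Subtracting the boundary term [E n / ln n] of a summation by parts makes the
   increments telescope against [1 / ln n]. *)
Lemma mertens_second (R : realType) : exists M C : R, forall n : nat, (1 < n)%N ->
  `|\sum_(0 <= p < n.+1 | prime p) p%:R^-1 - ln (ln n%:R) - M| <= C / ln n%:R.
Proof.
have [C C0 HC] := mertens_first R.
pose E n := \sum_(0 <= p < n.+1 | prime p) ln p%:R / p%:R - ln n%:R : R.
pose G n := \sum_(0 <= p < n.+1 | prime p) p%:R^-1 - ln (ln n%:R) - E n / ln n%:R : R.
pose H (n : nat) := if (n <= 1)%N then (1 + C) / ln 2 else (1 + C) / ln n%:R : R.
have l2 : 0 < ln 2 :> R by rewrite ln_gt0//; lra.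
have H0 n : 0 <= H n.
  rewrite /H; case: ltnP => n1; rewrite divr_ge0 ?ln_ge0 ?ler1n//; try lra.
  exact: ltnW.
have GH n : (2 <= n)%N -> `|G n.+1 - G n| <= H n - H n.+1.
  move=> n2; have n0 : (0 < n)%N by exact: ltnW.
  have -> : H n = (1 + C) / ln n%:R by rewrite /H leqNgt n2.
  have -> : H n.+1 = (1 + C) / ln n.+1%:R by rewrite /H ltnS leqNgt n0.
  have nR : 2 <= n%:R :> R by rewrite ler_nat.
  have sR : n.+1%:R = n%:R + 1 :> R by rewrite -natr1.
  have u0 : 0 < ln n%:R :> R by rewrite ln_gt0//; lra.
  have /andP[d0 d1] := @ln_natS_sub R _ n0.
  have i0 : 0 < n.+1%:R^-1 :> R by rewrite invr_gt0 ltr0n.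
  have i1 : n%:R^-1 <= 1 :> R by rewrite invf_le1; lra.
  set w := n.+1%:R^-1 in d0 i0.
  set u := ln n%:R in u0 d0 d1 *; set v := ln n.+1%:R in d0 d1 *.
  have v0 : 0 < v by lra.
  have uv : v^-1 <= u^-1 by rewrite lef_pV2 ?posrE//; lra.
  pose a := if prime n.+1 then (n.+1%:R^-1 : R) else 0.
  have PE : \sum_(0 <= p < n.+2 | prime p) p%:R^-1 =
      \sum_(0 <= p < n.+1 | prime p) p%:R^-1 + a :> R.
    by rewrite big_mkcond big_nat_recr//= -big_mkcond.
  have EE : E n.+1 = E n + a * v - v + u.
    rewrite /E big_mkcond big_nat_recr//= -big_mkcond -/u -/v /a.
    by case: ifP => _; rewrite ?mul0r; ring.
  (* If [n.+1] is prime, its contributions to the sum and to the boundary term cancel. The first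
     bracket is of second order in v - u and accounts for the 1 in [1 + C], the second term for the
     [C]. *)
  have -> : G n.+1 - G n = ((v - u) / v - (ln v - ln u)) + E n * (u^-1 - v^-1).
    rewrite /G PE EE -/u -/v; field; apply/andP; split; lra.
  have l1 : (v - u) / v <= ln v - ln u.
    rewrite -ln_div ?posrE//; apply: le_trans (ln_ge_1subV (divr_gt0 v0 u0)).
    by rewrite invf_div mulrBl divff ?gt_eqF.
  have l3 : ln v - ln u <= (v - u) / u.
    rewrite -ln_div ?posrE//; apply: le_trans (ln_le_subr1 (divr_gt0 v0 u0)) _.
    by rewrite mulrBl divff ?gt_eqF.
  have l4 : (v - u) / u - (v - u) / v <= u^-1 - v^-1.
    rewrite -mulrBr ler_piMl//; lra.
  have e1 : `|E n * (u^-1 - v^-1)| <= C * (u^-1 - v^-1).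
    by rewrite normrM [X in _ * X]ger0_norm ?subr_ge0// ler_wpM2r ?subr_ge0// HC.
  apply: le_trans (ler_normD _ _) _.
  rewrite [leRHS](_ : _ = (u^-1 - v^-1) + C * (u^-1 - v^-1)); last by ring.
  by apply: lerD => //; rewrite ler_norml; apply/andP; split; lra.
have [_ HG] := cvg_telescope H0 GH.
exists (limn G), (1 + C + C) => n n1; have := HG n n1.
rewrite /H leqNgt n1 /=.
have n0 : (0 < n)%N by exact: ltnW.
have u0 : 0 < ln n%:R :> R by rewrite ln_gt0// ltr1n.
have e1 : `|E n / ln n%:R| <= C / ln n%:R.
  by rewrite normrM [X in _ * X]ger0_norm ?invr_ge0 ?(ltW u0)// ler_wpM2r ?invr_ge0 ?(ltW u0)// HC.
move=> e2; rewrite mulrDl; apply: le_trans (lerD e2 e1).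
apply: le_trans (ler_normD _ _).
by rewrite le_eqVlt; apply/orP; left; apply/eqP; congr (`|_|); rewrite /G; ring.
Qed.

(** * The constant in Mertens' second theorem *)

(** Stands in for passages to the limit below, where the vanishing errors are put in the form C /
    n. *)
Lemma le_of_le_add_divn (R : realType) (x y C : R) (n0 : nat) :
  (forall n, (n0 <= n)%N -> (0 < n)%N -> x <= y + C / n%:R) -> x <= y.
Proof.
move=> H; rewrite leNgt; apply/negP => yx; have d0 : 0 < x - y by rewrite subr_gt0.
pose n := (n0 + (Num.truncn (`|C| / (x - y))).+1)%N.
have n1 : (0 < n)%N by rewrite /n addnS.
have nR : 0 < n%:R :> R by rewrite ltr0n.
have Cn : `|C| < (x - y) * n%:R.
  rewrite mulrC -ltr_pdivrMr//.
  apply: (@lt_le_trans _ _ (Num.truncn (`|C| / (x - y))).+1%:R).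
    by apply: real_truncnS_gt; rewrite num_real.
  by rewrite ler_nat leq_addl.
have := H n (leq_addr _ _) n1; rewrite -lerBlDl ler_pdivlMr// => H'.
have := ler_norm C; lra.
Qed.

Lemma eq0_of_le_divn (R : realType) (x C : R) (n0 : nat) :
  (forall n, (n0 <= n)%N -> (0 < n)%N -> `|x| <= C / n%:R) -> x = 0.
Proof.
move=> H; apply/eqP; rewrite -normr_le0.
by apply: (@le_of_le_add_divn _ _ _ C n0) => n ? ?; rewrite add0r H.
Qed.

Lemma ltn_square (n : nat) : (1 < n)%N -> (n < n ^ 2)%N.
Proof. by move=> n1; rewrite expnS expn1 ltn_Pmull// ltnW. Qed.

Lemma mertens_second_real (R : realType) : exists M C : R, 0 <= C /\
  forall x : R, 2 <= x ->
  `|\sum_(0 <= p < (Num.truncn x).+1 | prime p) p%:R^-1 - ln (ln x) - M| <= C / ln x.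
Proof.
have [M [C HC]] := mertens_second R; exists M, (2 * (C + 1)).
have l2 : 0 < ln 2 :> R by rewrite ln_gt0//; lra.
have C0 : 0 <= C.
  have := le_trans (normr_ge0 _) (HC 2%N isT).
  by rewrite pmulr_lge0// invr_gt0.
split=> [|x x2]; first by rewrite mulr_ge0//; lra.
have x0 : 0 <= x by lra.
have /andP[] := truncn_itv x0; set n := Num.truncn x => nx xn.
have n2 : (1 < n)%N by rewrite truncn_ge_nat.
have nR : 2 <= n%:R :> R by rewrite ler_nat.
have u0 : 0 < ln n%:R :> R by rewrite ln_gt0//; lra.
have uv : ln n%:R <= ln x by rewrite ler_ln ?posrE//; lra.
have v0 : 0 < ln x by lra.
have v1 : ln x <= ln n%:R + 1.
  have /andP[_] := @ln_natS_sub R n (ltnW n2).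
  have : n%:R^-1 <= 1 :> R by rewrite invf_le1; lra.
  have : ln x <= ln n.+1%:R by rewrite ler_ln ?posrE ?ltr0n// ?(ltW xn)//; lra.
  lra.
(* As x < n + 1 <= n^2, replacing 1 / ln n by 1 / ln x costs a factor 2. *)
have v2 : ln x <= 2 * ln n%:R.
  rewrite mulr_natl -lnXn; last by lra.
  rewrite ler_ln ?posrE ?exprn_gt0; try lra.
  apply: (le_trans (ltW xn)); rewrite -natrX ler_nat.
  exact: ltn_square.
have iu : (ln n%:R)^-1 <= 2 * (ln x)^-1.
  by rewrite -div1r ler_pdivrMr// mulrAC ler_pdivlMr// mul1r.
have l1 : `|ln (ln x) - ln (ln n%:R)| <= (ln n%:R)^-1.
  rewrite -ln_div ?posrE// ger0_norm; last first.
    by rewrite ln_ge0// ler_pdivlMr// mul1r.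
  apply: le_trans (ln_le_subr1 (divr_gt0 v0 u0)) _.
  rewrite lerBlDr -[X in _ + X](divff (lt0r_neq0 u0)) -[X in X + _]mul1r -mulrDl.
  by rewrite ler_pM2r ?invr_gt0//; lra.
have -> : 2 * (C + 1) / ln x = C * (2 * (ln x)^-1) + 2 * (ln x)^-1 by ring.
have e1 : C / ln n%:R <= C * (2 * (ln x)^-1) by rewrite ler_wpM2l.
have := HC n n2; move: l1; rewrite !ler_norml => /andP[? ?] /andP[? ?].
by apply/andP; split; lra.
Qed.

Lemma harmonic_gamma (R : realType) (n : nat) : (0 < n)%N ->
  `|\sum_(1 <= j < n.+1) j%:R^-1 - ln n%:R - euler_gamma R| <= n%:R^-1.
Proof.
move: n; pose H (n : nat) := if (n == 0)%N then 1 else n%:R^-1 : R.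
have H0 n : 0 <= H n by rewrite /H; case: eqP => // _; rewrite invr_ge0.
have [] := @cvg_telescope R (fun N => \sum_(1 <= j < N.+1) j%:R^-1 - ln N%:R) H 1 H0.
  move=> [//|n] _; rewrite big_nat_recr//= /H /=.
  have /andP[] := @ln_natS_sub R n.+1 isT.
  set a := ln _; set b := ln _; set S := \sum_(_ <= _ < _) _.
  set u := n.+2%:R^-1; set v := n.+1%:R^-1 => ? ?.
  by rewrite ler_norml; apply/andP; split; lra.
by move=> _ HG n n0; have := HG n n0; rewrite /H eqn0Ngt n0.
Qed.

Lemma is_derive_sum_pow (R : realType) (J : nat) (x : R) :
  is_derive x 1 (fun x => \sum_(0 <= j < J) x ^+ j.+1 / j.+1%:R : R)
    (\sum_(0 <= j < J) x ^+ j).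
Proof.
elim: J => [|J IHJ].
  rewrite big_nil.
  have -> : (fun x : R => \sum_(0 <= j < 0) x ^+ j.+1 / j.+1%:R) = cst 0.
    by apply/funext => y; rewrite big_nil.
  exact: is_derive_cst.
rewrite big_nat_recr//=.
have -> : (fun x : R => \sum_(0 <= j < J.+1) x ^+ j.+1 / j.+1%:R) =
    (fun x : R => \sum_(0 <= j < J) x ^+ j.+1 / j.+1%:R) \+ (fun x => J.+1%:R^-1 * x ^+ J.+1).
  by apply/funext => y; rewrite big_nat_recr//= mulrC.
apply: is_deriveD.
have := is_deriveZ (J.+1%:R^-1 : R) (is_deriveX J.+1 (is_derive_id x (1 : R))).
have -> : (J.+1%:R^-1 : R) \*: (id : R -> R) ^+ J.+1 = fun y => J.+1%:R^-1 * y ^+ J.+1.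
  by apply/funext => y /=; rewrite exprfctE.
by rewrite /GRing.scale /= mulr1 mulrA mulVf ?mul1r// pnatr_eq0.
Qed.

(** By the geometric sum, the remainder has derivative x^J / (1 - x), so the mean value theorem
    bounds it. *)
Lemma log_series_bounds (R : realType) (q : R) (J : nat) : 0 < q < 1 ->
  0 <= - ln (1 - q) - \sum_(0 <= j < J) q ^+ j.+1 / j.+1%:R <= q ^+ J / (1 - q).
Proof.
move=> /andP[q0 q1]; pose F (x : R) := - ln (1 - x) - \sum_(0 <= j < J) x ^+ j.+1 / j.+1%:R.
have dF (x : R) : 0 <= x <= q -> is_derive x 1 F (x ^+ J / (1 - x)).
  move=> /andP[x0 xq]; have x1 : 0 < 1 - x by lra.
  have E : x ^+ J / (1 - x) = (1 - x)^-1 - \sum_(0 <= j < J) x ^+ j.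
    have := subrX1 x J; rewrite big_mkord => E'.
    have -> : \sum_(i < J) x ^+ i = (1 - x ^+ J) / (1 - x).
      by rewrite -opprB E'; field; lra.
    by field; lra.
  rewrite E; apply: is_deriveB; last exact: is_derive_sum_pow.
  rewrite -[(1 - x)^-1]opprK; apply: is_deriveN.
  have d1 : is_derive x (1 : R) (fun y : R => 1 - y) (-1).
    by have := is_deriveB (is_derive_cst (1 : R) x (1 : R)) (is_derive_id x (1 : R));
      rewrite sub0r.
  by have := @is_derive1_comp R (@ln R) (fun y => 1 - y) x _ _ (is_derive1_ln x1) d1;
    rewrite mulrN1.
have cF : {within `[0, q], continuous F}.
  apply: derivable_within_continuous => x; rewrite in_itv /= => xq.
  by have [] := dF x xq.
have [|c cq] := @MVT R F (fun x => x ^+ J / (1 - x)) 0 q q0 _ cF.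
  by move=> x; rewrite in_itv /= => /andP[? ?]; apply: dF; rewrite !ltW.
move: cq; rewrite in_itv /= => /andP[c0 cq].
have -> : F 0 = 0.
  rewrite /F subr0 ln1 oppr0 sub0r big1 ?oppr0// => j _.
  by rewrite exprS !mul0r.
rewrite !subr0 -/(F q) => ->.
have c1 : 0 < 1 - c by lra.
have q1' : 0 < 1 - q by lra.
have cJ : c ^+ J <= q ^+ J by rewrite lerXn2r ?nnegrE ?ltW.
have cJ0 : 0 <= c ^+ J by rewrite exprn_ge0// ltW.
have D0 : 0 <= c ^+ J / (1 - c) by rewrite divr_ge0// ltW.
apply/andP; split; first by rewrite mulr_ge0// ltW.
apply: (@le_trans _ _ (c ^+ J / (1 - c))); first by rewrite ler_piMr// ltW.
apply: ler_pM => //; first by rewrite invr_ge0 ltW.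
by rewrite lef_pV2 ?posrE//; lra.
Qed.

Lemma zeta_sum_le (R : realType) (s : R) (N : nat) : 0 < s ->
  \sum_(0 <= n < N) n%:R `^ (- (1 + s)) <= 1 + s^-1.
Proof.
(* Keeping the boundary term makes the bound inductive. The term at 0 vanishes, since 0 to a nonzero
   power is 0. *)
move=> s0; suff H : \sum_(0 <= n < N.+2) n%:R `^ (- (1 + s)) <=
    1 + s^-1 - s^-1 * N.+1%:R `^ (- s).
  apply: le_trans (_ : _ <= \sum_(0 <= n < N.+2) n%:R `^ (- (1 + s))) _.
    by rewrite !big_nat_recr//= -addrA lerDl addr_ge0 ?powR_ge0.
  by apply: le_trans H _; rewrite gerBl mulr_ge0 ?powR_ge0 ?invr_ge0 ?ltW.
elim: N => [|N IHN].
  rewrite !big_nat_recr//= big_nil add0r !powR1 powR0 ?add0r; first lra.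
  by rewrite oppr_eq0 gt_eqF//; lra.
rewrite big_nat_recr//=.
have := powRN_sub_ge (ltr0Sn R N) s0; rewrite natr1 -ler_pdivlMl// => H.
rewrite mulrBr in H; lra.
Qed.

Lemma zeta_sum_ge (R : realType) (s : R) (N : nat) : 0 < s -> (0 < N)%N ->
  (1 - N%:R `^ (- s)) / s <= \sum_(0 <= n < N) n%:R `^ (- (1 + s)).
Proof.
move=> s0; case: N => // N _; elim: N => [|N IHN].
  by rewrite powR1 subrr mul0r sumr_ge0// => n _; exact: powR_ge0.
rewrite big_nat_recr//=.
have := powRN_sub_le (ltr0Sn R N) s0; rewrite natr1 -ler_pdivrMl// => H.
rewrite mulrC mulrBr in IHN; rewrite mulrC mulrBr; rewrite mulrBr in H; lra.
Qed.

Definition zeta_prod (R : realType) (s : R) (N : nat) : R :=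
  \prod_(0 <= p < N | prime p) (1 - p%:R `^ (- (1 + s)))^-1.

Lemma prime_powRN_lt1 (R : realType) (s : R) (p : nat) : 0 < s -> prime p ->
  0 < p%:R `^ (- (1 + s)) <= (2^-1 : R).
Proof.
move=> s0 pp; have p2 : 2 <= p%:R :> R by rewrite ler_nat prime_gt1.
have p0 : 0 < p%:R :> R by lra.
have p1 : 1 <= p%:R :> R by lra.
have s1 : 1 <= 1 + s by lra.
rewrite powR_gt0//= powRN lef_pV2 ?posrE ?powR_gt0//.
exact: le_trans p2 (le1r_powR p1 s1).
Qed.

(** A positive n < N has all its prime factors and exponents below [N], so it occurs in the
    expansion of the product of geometric sums truncated at [N]. *)
Lemma zeta_prod_ge (R : realType) (s : R) (N : nat) : 0 < s ->
  \sum_(0 <= n < N) n%:R `^ (- (1 + s)) <= zeta_prod s N.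
Proof.
move=> s0; have e0 : - (1 + s) != 0 by rewrite oppr_eq0 gt_eqF//; lra.
apply: (@le_trans _ _ (\prod_(0 <= p < N | prime p)
    \sum_(e <- iota 0 N) (p ^ e)%:R `^ (- (1 + s)))).
  rewrite -(@sum_euler_list _ prime _ _ (fun n => n%:R `^ (- (1 + s))))//; last 2 first.
  - by rewrite powR1.
  - by move=> m n _ _; exact: powR_natM.
  apply: (@le_trans _ _ (\sum_(n <- [seq n <- index_iota 0 N | (0 < n)%N]) n%:R `^ (- (1 + s)))).
    rewrite big_filter [leRHS]big_mkcond /=; apply: ler_sum => n _.
    by case: n => [|n] //=; rewrite powR0.
  apply: ler_sum_subset.
  - by rewrite filter_uniq// iota_uniq.
  - by rewrite uniq_euler_list ?iota_uniq.
  - move=> n; rewrite mem_filter mem_index_iota => /andP[n0 nN].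
    apply/mem_euler_list => //; split=> // p pp; rewrite pp /=; case: ifPn => [_|].
      by rewrite mem_iota /= (leq_trans (ltn_logl p n0))// ltnW.
    rewrite -leqNgt => Np; rewrite -leqn0 leqNgt logn_gt0 mem_primes pp n0 /=.
    by rewrite gtnNdvd// (leq_trans nN Np).
  - by move=> n; exact: powR_ge0.
apply: ler_prod => p pp; rewrite sumr_ge0//=.
have /andP[t0 t1] := @prime_powRN_lt1 R s p s0 pp.
under eq_bigr do rewrite powR_natX.
set t := _ `^ _ in t0 t1 *; have := subrX1 t N.
have -> : \sum_(i <- iota 0 N) t ^+ i = \sum_(0 <= i < N) t ^+ i by rewrite /index_iota subn0.
rewrite big_mkord => E; rewrite -div1r ler_pdivlMr; last by lra.
have : 0 <= t ^+ N by rewrite exprn_ge0// ltW.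
lra.
Qed.

Lemma zeta_prod_gt0 (R : realType) (s : R) (N : nat) : 0 < s -> 0 < zeta_prod s N.
Proof.
move=> s0; apply: prodr_gt0 => p pp; rewrite invr_gt0.
have := @prime_powRN_lt1 R s p s0 pp; lra.
Qed.

(** Bernoulli's inequality in product form. It pays for cutting off every geometric series in
    [zeta_prod_le]. *)
Lemma prodr_mul_ge (R : realDomainType) (P : pred nat) (a : nat -> R) (x : R) (N : nat) :
  (forall i, P i -> 0 <= a i) -> 0 <= x <= 1 ->
  (1 - N%:R * x) * \prod_(0 <= i < N | P i) a i <=
  \prod_(0 <= i < N | P i) ((1 - x) * a i).
Proof.
move=> a0 /andP[x0 x1]; elim: N => [|N IHN].
  by rewrite !big_nil mul0r subr0 mulr1.
rewrite !(big_mkcond P) !big_nat_recr//= -!(big_mkcond P) /=.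
have A0 : 0 <= \prod_(0 <= i < N | P i) a i by exact: prodr_ge0.
set A := \prod_(_ <= _ < _ | _) _ in IHN A0 *.
set B := \prod_(_ <= _ < _ | _) _ in IHN *.
have N0 : 0 <= N%:R :> R by [].
rewrite -natr1; case: ifPn => PN; last first.
  rewrite !mulr1; apply: le_trans IHN; rewrite ler_wpM2r//; lra.
have aN := a0 N PN.
apply: (@le_trans _ _ ((1 - N%:R * x) * A * ((1 - x) * a N))); last first.
  by rewrite ler_wpM2r// mulr_ge0//; lra.
rewrite [leRHS](_ : _ = (1 - N%:R * x) * (1 - x) * (A * a N)); last by ring.
rewrite ler_wpM2r ?mulr_ge0//; have : 0 <= N%:R * x * x by rewrite !mulr_ge0.
lra.
Qed.

(** Cutting a geometric series of ratio t <= 1/2 after [E] terms keeps the fraction 1 - t^E >= 1 -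
    1/E of it. The truncated product expands into distinct terms of the zeta sum, and then [E] tends
    to infinity with [N] fixed. *)
Lemma zeta_prod_le (R : realType) (s : R) (N : nat) : 0 < s -> zeta_prod s N <= 1 + s^-1.
Proof.
move=> s0; have Z0 := @zeta_prod_gt0 R s N s0.
apply: (@le_of_le_add_divn _ _ _ (N%:R * zeta_prod s N) 0) => E _ E0.
have ER : 0 < E%:R :> R by rewrite ltr0n.
pose x : R := E%:R^-1; have x0 : 0 <= x by rewrite invr_ge0 ltW.
have x1 : x <= 1 by rewrite invf_le1// ler1n.
have x01 : 0 <= x <= 1 by rewrite x0 x1.
suff H : \prod_(0 <= p < N | prime p) ((1 - x) * (1 - p%:R `^ (- (1 + s)))^-1) <= 1 + s^-1.
  rewrite -/x -[leLHS](subrK (N%:R * x * zeta_prod s N)) mulrAC lerD2r.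
  apply: le_trans H; apply: le_trans (prodr_mul_ge _ _ x01).
    by rewrite -/(zeta_prod s N); lra.
  move=> p pp; rewrite invr_ge0; have := @prime_powRN_lt1 R s p s0 pp; lra.
apply: (@le_trans _ _ (\prod_(0 <= p < N | prime p)
    \sum_(e <- iota 0 E) (p ^ e)%:R `^ (- (1 + s)))).
  apply: ler_prod => p pp; have /andP[t0 t1] := @prime_powRN_lt1 R s p s0 pp.
  rewrite mulr_ge0 ?invr_ge0; [|lra|lra] => /=.
  under eq_bigr do rewrite powR_natX.
  set t := _ `^ _ in t0 t1 *; have := subrX1 t E.
  have -> : \sum_(i <- iota 0 E) t ^+ i = \sum_(0 <= i < E) t ^+ i by rewrite /index_iota subn0.
  rewrite big_mkord => tE; rewrite ler_pdivrMr; last by lra.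
  have tx : t ^+ E <= x.
    apply: (@le_trans _ _ (2^-1 ^+ E)); first by rewrite lerXn2r// nnegrE ?invr_ge0// ltW.
    rewrite exprVn lef_pV2 ?posrE ?exprn_gt0//.
    by rewrite -natrX ler_nat ltnW// ltn_expl.
  lra.
rewrite -(@sum_euler_list _ prime _ _ (fun n => n%:R `^ (- (1 + s))))//; last 2 first.
- by rewrite powR1.
- by move=> m n _ _; exact: powR_natM.
pose M := (\sum_(n <- euler_list prime (iota 0 E) N) n).+1%N.
apply: le_trans (zeta_sum_le M s0); apply: ler_sum_subset.
- by rewrite uniq_euler_list ?iota_uniq.
- by rewrite iota_uniq.
- by move=> n nL; rewrite mem_index_iota /= ltnS (big_rem n)//= leq_addr.
- by move=> n; exact: powR_ge0.
Qed.

(** Meant for u = 1/p. With l = p^(-e) it compares the logarithm of an Euler factor at 1 + e with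
    the one at 1. With l = 0 it bounds the terms of [prime_log_gap]. *)
Lemma log_gap_bounds (R : realType) (u l : R) : 0 < u < 1 -> 0 <= l <= 1 ->
  0 <= (- ln (1 - u) - u) - (- ln (1 - l * u) - l * u) <= (1 - l) * (u ^+ 2 / (1 - u)).
Proof.
move=> /andP[u0 u1] /andP[l0 l1].
have a0 : 0 < 1 - u by lra.
have lu : l * u <= u by rewrite ler_piMl ?(ltW u0).
have lu0 : 0 <= l * u by rewrite mulr_ge0 ?(ltW u0).
have b0 : 0 < 1 - l * u by lra.
have -> : - ln (1 - u) - u - (- ln (1 - l * u) - l * u) =
   ln ((1 - l * u) / (1 - u)) - (1 - l) * u by rewrite ln_div ?posrE//; ring.
have h1 := ln_ge_1subV (divr_gt0 b0 a0); rewrite invf_div in h1.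
have h2 := ln_le_subr1 (divr_gt0 b0 a0).
have e1 : 1 - (1 - u) / (1 - l * u) = (1 - l) * u / (1 - l * u) by field; lra.
have e2 : (1 - l * u) / (1 - u) - 1 = (1 - l) * u / (1 - u) by field; lra.
have e3 : (1 - l) * (u ^+ 2 / (1 - u)) = (1 - l) * u / (1 - u) - (1 - l) * u.
  by field; lra.
have m0 : 0 <= (1 - l) * u by rewrite mulr_ge0//; lra.
have h3 : (1 - l) * u <= (1 - l) * u / (1 - l * u).
  by rewrite ler_pdivlMr// ler_piMr//; lra.
rewrite e1 in h1; rewrite e2 in h2; apply/andP; split; lra.
Qed.

Definition prime_log_gap (R : realType) (N : nat) : R :=
  \sum_(0 <= p < N | prime p) (ln (1 - p%:R^-1) + p%:R^-1).

(** The term at [p] is at most 1/(p-1) - 1/p in absolute value, which telescopes. *)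
Lemma prime_log_gap_dist (R : realType) (n : nat) : (1 < n)%N ->
  `|prime_log_gap R n - limn (prime_log_gap R)| <= 2 / n%:R.
Proof.
pose H (n : nat) := if (n <= 1)%N then 1 else n.-1%:R^-1 : R.
have H0 m : 0 <= H m by rewrite /H; case: ifP => // _; rewrite invr_ge0.
have [] := @cvg_telescope R (prime_log_gap R) H 2 H0.
  move=> [|[|m]]// _; rewrite /H /= /prime_log_gap big_mkcond big_nat_recr//=.
  rewrite -big_mkcond addrAC subrr add0r.
  have mR : 0 < m.+1%:R :> R by rewrite ltr0n.
  have mS : m.+2%:R = m.+1%:R + 1 :> R by rewrite -natr1.
  case: ifP => _; last first.
    by rewrite normr0 subr_ge0 lef_pV2 ?posrE ?ltr0n// ler_nat.
  rewrite mS; set x := m.+1%:R in mR *; have x1 : 0 < x + 1 by lra.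
  have u01 : 0 < (x + 1)^-1 < 1 by rewrite invr_gt0 x1 invf_lt1//; lra.
  have := log_gap_bounds u01 (_ : 0 <= 0 <= 1).
  rewrite lexx ler01 => /(_ isT); rewrite mul0r !subr0 ln1 oppr0 subr0 mul1r.
  have -> : (x + 1)^-1 ^+ 2 / (1 - (x + 1)^-1) = x^-1 - (x + 1)^-1.
    by field; apply/andP; split; lra.
  set L := ln _; set u := (x + 1)^-1; set v := x^-1 => /andP[? ?].
  by rewrite ler_norml; apply/andP; split; lra.
move=> _ HG n1; have := HG n n1; rewrite /H leqNgt n1 /= => /le_trans; apply.
have n0 : 0 < n.-1%:R :> R by rewrite ltr0n; case: n n1 => [|[]].
have nR : 0 < n%:R :> R by rewrite ltr0n ltnW.
rewrite ler_pdivlMr// mulrC ler_pdivrMr// -natrM ler_nat.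
by case: n n1 {n0 nR} => [|[|n]]// _ /=; rewrite mul2n -addnn addnS addSn ltnS leq_addr.
Qed.

(** * Grouping the primes by the integral part of their logarithm *)

Definition exp_bound (R : realType) (j : nat) : nat := (Num.truncn (expR (j%:R : R))).+1.

Definition prime_recip (R : realType) (j : nat) : R :=
  \sum_(0 <= p < exp_bound R j | prime p) p%:R^-1.

Lemma ltn_exp_bound (R : realType) (j p : nat) :
  (p < exp_bound R j)%N = (p%:R <= expR (j%:R : R)).
Proof. by rewrite ltnS truncn_ge_nat ?expR_ge0. Qed.

Lemma exp_bound_le (R : realType) (j : nat) : (exp_bound R j <= exp_bound R j.+1)%N.
Proof. by rewrite ltnS le_truncn// ler_expR ler_nat. Qed.

Lemma exp_bound_ge (R : realType) (j : nat) : expR (j%:R : R) <= (exp_bound R j)%:R.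
Proof. by apply: ltW; apply: real_truncnS_gt; rewrite num_real. Qed.

Lemma exp_bound_ge_nat (R : realType) (j : nat) : (j < exp_bound R j)%N.
Proof.
by rewrite ltn_exp_bound; have := expR_ge1Dx (j%:R : R); lra.
Qed.

Lemma exp_bound0 (R : realType) : exp_bound R 0 = 2%N.
Proof.
by rewrite /exp_bound expR0; congr _.+1; apply: truncn_def; rewrite lexx ltr1n.
Qed.

Lemma prime_recip0 (R : realType) : prime_recip R 0 = 0.
Proof. by rewrite /prime_recip exp_bound0 big_mkcond !big_nat_recr//= big_nil !add0r. Qed.

(** For q = exp(-e), the sum of p^(-1-e) with p^(-e) replaced by its lower bound q^(j+1) on the
    block j < ln p <= j + 1. *)
Definition block_sum (R : realType) (q : R) (J : nat) : R :=
  \sum_(0 <= j < J) (prime_recip R j.+1 - prime_recip R j) * q ^+ j.+1.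

(** On the block with index j, p^(-e) lies between q^(j+1) and q^j = exp(e) * q^(j+1). *)
Lemma block_bounds (R : realType) (e : R) (J : nat) : 0 < e ->
  block_sum (expR (- e)) J <=
    \sum_(0 <= p < exp_bound R J | prime p) p%:R `^ (- (1 + e)) <=
    expR e * block_sum (expR (- e)) J.
Proof.
move=> e0; rewrite /block_sum; set q := expR (- e); elim: J => [|J IHJ].
  rewrite exp_bound0 [X in _ <= X <= _]big_mkcond.
  by rewrite [X in _ <= X <= _]big_nat_recr//= big_nat1 addr0 big_nil mulr0 lexx.
have q0 : 0 < q by exact: expR_gt0.
have pR p : prime p -> 0 < p%:R :> R by move=> pp; rewrite ltr0n prime_gt0.
have split F : \sum_(0 <= p < exp_bound R J.+1 | prime p) F p =
    \sum_(0 <= p < exp_bound R J | prime p) F p +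
    \sum_(exp_bound R J <= p < exp_bound R J.+1 | prime p) F p :> R.
  by rewrite (@big_cat_nat _ _ _ (exp_bound R J))//= exp_bound_le.
have dP : prime_recip R J.+1 - prime_recip R J =
    \sum_(exp_bound R J <= p < exp_bound R J.+1 | prime p) p%:R^-1.
  by rewrite /prime_recip split addrAC subrr add0r.
rewrite big_nat_recr//= dP split.
set D := \sum_(_ <= p < _ | _) p%:R^-1.
have qE k p : 0 < p%:R :> R -> p%:R <= expR (k%:R : R) -> q ^+ k <= p%:R `^ (- e).
  move=> p0 pk; rewrite /q -expRM_natl /powR gt_eqF// ler_expR mulrN mulNr lerN2.
  rewrite mulrC ler_pM2r//; rewrite -[leRHS]expRK ler_ln ?posrE ?expR_gt0//.
have qE' k p : expR (k%:R : R) <= p%:R -> p%:R `^ (- e) <= q ^+ k.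
  move=> pk; have p0 : 0 < p%:R :> R by apply: lt_le_trans pk; rewrite expR_gt0.
  rewrite /q -expRM_natl /powR gt_eqF// ler_expR mulrN mulNr lerN2.
  by rewrite mulrC ler_pM2l// -[leLHS]expRK ler_ln ?posrE ?expR_gt0.
have lo : D * q ^+ J.+1 <=
    \sum_(exp_bound R J <= p < exp_bound R J.+1 | prime p) p%:R `^ (- (1 + e)).
  rewrite mulr_suml big_nat_cond [leRHS]big_nat_cond.
  apply: ler_sum => p /andP[/andP[_ pJ] pp].
  rewrite powRNS ?pR// mulrC ler_wpM2r ?invr_ge0// qE ?pR//.
  by rewrite -ltn_exp_bound.
have hi : \sum_(exp_bound R J <= p < exp_bound R J.+1 | prime p) p%:R `^ (- (1 + e))
    <= expR e * (D * q ^+ J.+1).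
  have -> : expR e * (D * q ^+ J.+1) = D * q ^+ J.
    have qe : expR e * q = 1 by rewrite expRxMexpNx_1.
    by rewrite exprS mulrCA (mulrA (expR e)) qe mul1r.
  rewrite mulr_suml big_nat_cond [leRHS]big_nat_cond.
  apply: ler_sum => p /andP[/andP[Jp _] pp].
  rewrite powRNS ?pR// mulrC ler_wpM2l ?invr_ge0// qE'//.
  by apply: le_trans (exp_bound_ge R J) _; rewrite ler_nat.
move: IHJ => /andP[IH1 IH2]; rewrite mulrDr; apply/andP; split; exact: lerD.
Qed.

(** Summation by parts; [s * q] is the boundary term at 0. The sum in the error stays below -ln(1 -
    q), so its product with [1 - q] vanishes as q tends to 1. *)
Lemma abel_partial (R : realType) (q K s : R) (r : nat -> R) (J : nat) :
  0 < q < 1 -> r 0%N = - s -> (forall j, `|r j.+1| <= K / j.+1%:R) ->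
  `|\sum_(0 <= j < J.+1) (r j.+1 - r j) * q ^+ j.+1 - s * q| <=
  K / J.+1%:R + (1 - q) * K * \sum_(0 <= j < J) q ^+ j.+1 / j.+1%:R.
Proof.
move=> /andP[q0 q1] r0 rK.
have -> : \sum_(0 <= j < J.+1) (r j.+1 - r j) * q ^+ j.+1 - s * q =
    r J.+1 * q ^+ J.+1 + (1 - q) * \sum_(0 <= j < J) r j.+1 * q ^+ j.+1.
  elim: J => [|J IHJ]; first by rewrite !big_nat_recr//= !big_nil r0 expr1; ring.
  rewrite big_nat_recr// addrAC IHJ [in RHS]big_nat_recr//= !exprS; ring.
apply: le_trans (ler_normD _ _) _; apply: lerD.
  have qJ : 0 <= q ^+ J.+1 by rewrite exprn_ge0// ltW.
  rewrite normrM (ger0_norm qJ); apply: le_trans (rK J).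
  by rewrite ler_piMr// exprn_ile1// ltW.
rewrite normrM ger0_norm; last by lra.
rewrite -mulrA ler_wpM2l; [by []|lra|].
apply: le_trans (ler_norm_sum _ _ _) _; rewrite mulr_sumr; apply: ler_sum => j _.
have qj : 0 <= q ^+ j.+1 by rewrite exprn_ge0// ltW.
by rewrite normrM (ger0_norm qj) mulrCA mulrC ler_wpM2l.
Qed.

(** At x = exp(j+1), ln (ln x) is ln(j+1), which is a harmonic number minus Euler's constant up to
    1/(j+1). This is where that constant enters. *)
Lemma prime_recip_harmonic (R : realType) (M : R) (C : R) : 0 <= C ->
  (forall x : R, 2 <= x ->
  `|\sum_(0 <= p < (Num.truncn x).+1 | prime p) p%:R^-1 - ln (ln x) - M| <= C / ln x) ->
  forall j, `|prime_recip R j.+1 - \sum_(1 <= i < j.+2) i%:R^-1 - (M - euler_gamma R)|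
     <= (C + 1) / j.+1%:R.
Proof.
move=> C0 HM j; have jR : 1 <= j.+1%:R :> R by rewrite ler1n.
have := HM (expR j.+1%:R); rewrite expRK -/(exp_bound R j.+1) -/(prime_recip R j.+1).
have e2 : 2 <= expR (j.+1%:R : R) by have := expR_ge1Dx (j.+1%:R : R); lra.
move=> /(_ e2); have := harmonic_gamma R (ltn0Sn j).
set P := prime_recip R _; set H := \sum_(_ <= _ < _) _; set v := j.+1%:R.
have -> : (C + 1) / v = C / v + v^-1 by ring.
rewrite !ler_norml; set a := C / v; set b := v^-1 => /andP[? ?] /andP[? ?].
by apply/andP; split; lra.
Qed.

(** [log_gap_bounds] at u = 1/p and l = p^(-e), with 1 - l <= e * ln p. *)
Lemma zeta_log_term_bounds (R : realType) (e : R) (p : nat) : 0 < e -> prime p ->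
  let x := p%:R `^ (- (1 + e)) - (ln (1 - p%:R^-1) + p%:R^-1) : R in
  x - e * (ln p%:R / (p%:R * (p%:R - 1))) <= - ln (1 - p%:R `^ (- (1 + e))) /\
  - ln (1 - p%:R `^ (- (1 + e))) <= x.
Proof.
move=> e0 pp x; have p1 : 1 < p%:R :> R by rewrite ltr1n prime_gt1.
have p0 : 0 < p%:R :> R by lra.
have u01 : 0 < (p%:R^-1 : R) < 1 by rewrite invr_gt0 p0 invf_lt1.
pose l := p%:R `^ (- e) : R.
have lp : 0 < ln p%:R :> R by rewrite ln_gt0.
have lE : l = expR (- (e * ln p%:R)) by rewrite /l /powR gt_eqF// mulNr.
have l1 : 1 - l <= e * ln p%:R.
  by have := expR_ge1Dx (- (e * ln p%:R)); rewrite -lE; lra.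
have l01 : 0 <= l <= 1.
  by rewrite /l powR_ge0 -/l lE expR_le1 oppr_le0 mulr_ge0// ltW.
have tE : p%:R `^ (- (1 + e)) = l * p%:R^-1 by rewrite powRNS.
have := log_gap_bounds u01 l01; rewrite /x tE.
have -> : p%:R^-1 ^+ 2 / (1 - p%:R^-1) = (p%:R * (p%:R - 1))^-1 :> R.
  by field; apply/andP; split; lra.
set v := (_ * (_ - 1))^-1; have v0 : 0 <= v by rewrite invr_ge0 mulr_ge0//; lra.
have m : (1 - l) * v <= e * (ln p%:R * v) by rewrite mulrA ler_wpM2r.
set A := ln (1 - p%:R^-1); set B := ln (1 - l * _); set w := p%:R^-1.
move=> /andP[? ?]; split; lra.
Qed.

Lemma ln_zeta_prod_bounds (R : realType) (e : R) (N : nat) : 0 < e ->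
  let S := \sum_(0 <= p < N | prime p) p%:R `^ (- (1 + e)) in
  let G := \sum_(0 <= p < N | prime p) ln p%:R / (p%:R * (p%:R - 1)) in
  S - prime_log_gap R N - e * G <= ln (zeta_prod e N) /\
  ln (zeta_prod e N) <= S - prime_log_gap R N.
Proof.
move=> e0 S G.
have -> : ln (zeta_prod e N) =
    \sum_(0 <= p < N | prime p) - ln (1 - p%:R `^ (- (1 + e))).
  rewrite /zeta_prod ln_prod => [|p pp]; last first.
    by rewrite invr_gt0; have := @prime_powRN_lt1 R e p e0 pp; lra.
  apply: eq_bigr => p pp; rewrite lnV// posrE.
  by have := @prime_powRN_lt1 R e p e0 pp; lra.
rewrite /S /G /prime_log_gap mulr_sumr -!sumrB; split.
  by apply: ler_sum => p pp; have [] := zeta_log_term_bounds e0 pp.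
by apply: ler_sum => p pp; have [] := zeta_log_term_bounds e0 pp.
Qed.

Lemma block_sum_bounds (R : realType) (M C q : R) (J : nat) : 0 <= C -> 0 < q < 1 ->
  (forall j, `|prime_recip R j.+1 - \sum_(1 <= i < j.+2) i%:R^-1 - (M - euler_gamma R)|
     <= C / j.+1%:R) ->
  `|block_sum q J.+1 - (- ln (1 - q) + (M - euler_gamma R) * q)| <=
  C / J.+1%:R + (1 - q) * C * - ln (1 - q) + q ^+ J.+1 / (1 - q).
Proof.
move=> C0 q01 HC; have /andP[q0 q1] := q01; set s := M - _ in HC *.
pose r j := prime_recip R j - \sum_(1 <= i < j.+1) i%:R^-1 - s.
have r0 : r 0%N = - s by rewrite /r prime_recip0 big_geq// subrr sub0r.
have := abel_partial J q01 r0 HC.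
have -> : \sum_(0 <= j < J.+1) (r j.+1 - r j) * q ^+ j.+1 =
    block_sum q J.+1 - \sum_(0 <= j < J.+1) q ^+ j.+1 / j.+1%:R.
  rewrite /block_sum -sumrB; apply: eq_bigr => j _.
  by rewrite /r [X in _ - X - _ - _]big_nat_recr//=; ring.
have /andP[] := log_series_bounds J.+1 q01.
have /andP[] := log_series_bounds J q01.
set f := \sum_(0 <= j < J) _; set f1 := \sum_(0 <= j < J.+1) _.
set L := - ln _; set T := block_sum _ _ => f0 _ f10 f11.
have m : (1 - q) * C * f <= (1 - q) * C * L.
  by rewrite ler_wpM2l ?mulr_ge0//; lra.
set D := q ^+ _ / _ in f11 *; set Z := C / _.
by rewrite !ler_norml => /andP[? ?]; apply/andP; split; lra.
Qed.

Lemma expRN_pow_le (R : realType) (e : R) (J : nat) : 0 < e -> (0 < J)%N ->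
  expR (- e) ^+ J <= e^-1 / J%:R.
Proof.
move=> e0 J0; have JR : 0 < J%:R :> R by rewrite ltr0n.
rewrite -expRM_natl mulrN expRN -invfM lef_pV2 ?posrE ?expR_gt0 ?mulr_gt0//.
by have := expR_ge1Dx (J%:R * e); rewrite mulrC; lra.
Qed.

(** Here [e] is fixed and the number [J] of blocks tends to infinity. The two inequalities come from
    the upper bound 1 + 1/e and the lower bound (1 - N^(-e)) / e for the Euler product. *)
Lemma mertens_constant_sandwich (R : realType) (M C K e : R) : 0 <= C ->
  (forall j, `|prime_recip R j.+1 - \sum_(1 <= i < j.+2) i%:R^-1 - (M - euler_gamma R)|
     <= C / j.+1%:R) ->
  (forall N, \sum_(0 <= p < N | prime p) ln p%:R / (p%:R * (p%:R - 1)) <= K) ->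
  0 < e ->
  let q := expR (- e) in
  let L := - ln (1 - q) in
  let s := M - euler_gamma R in
  let b := limn (prime_log_gap R) in
  L + s * q - (1 - q) * C * L - b - e * K <= ln (1 + e^-1) /\
  - ln e <= expR e * (L + s * q + (1 - q) * C * L) - b.
Proof.
move=> C0 HC HK e0 q L s b.
have q0 : 0 < q by exact: expR_gt0.
have q1 : q < 1 by rewrite /q expR_lt1; lra.
have q01 : 0 < q < 1 by rewrite q0 q1.
have JB J : `|block_sum q J.+1 - (L + s * q)| <=
    (C + e^-1 / (1 - q)) / J.+1%:R + (1 - q) * C * L.
  apply: le_trans (block_sum_bounds J C0 q01 HC) _; rewrite -/L.
  have : q ^+ J.+1 / (1 - q) <= e^-1 / J.+1%:R / (1 - q).
    by rewrite ler_wpM2r ?invr_ge0 ?expRN_pow_le//; lra.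
  have -> : (C + e^-1 / (1 - q)) / J.+1%:R = C / J.+1%:R + e^-1 / J.+1%:R / (1 - q).
    by rewrite mulrDl [X in _ + X]mulrAC.
  set a := C / _; set c := (1 - q) * C * L; set d := _ / (1 - q); lra.
have bB J : `|prime_log_gap R (exp_bound R J.+1) - b| <= 2 / J.+1%:R.
  have Jb := exp_bound_ge_nat R J.+1.
  apply: le_trans (prime_log_gap_dist R _) _; first by apply: leq_ltn_trans Jb.
  rewrite ler_wpM2l// lef_pV2 ?posrE ?ltr0n//.
  by rewrite ler_nat ltnW.
set D := C + e^-1 / (1 - q) in JB.
split.
  apply: (@le_of_le_add_divn _ _ _ (D + 2) 1) => -[|J]// _ _.
  have := JB J; have := bB J.
  have /andP[+ _] := block_bounds J.+1 e0; rewrite -/q.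
  have [zl _] := ln_zeta_prod_bounds (exp_bound R J.+1) e0; move: zl.
  have eG := ler_wpM2l (ltW e0) (HK (exp_bound R J.+1)).
  have : ln (zeta_prod e (exp_bound R J.+1)) <= ln (1 + e^-1).
    by rewrite ler_ln ?posrE ?zeta_prod_gt0 ?zeta_prod_le// addr_gt0 ?invr_gt0.
  set W := ln (zeta_prod _ _).
  set g := prime_log_gap R _; set T := block_sum _ _; set Z := ln (1 + _).
  rewrite [(D + 2) / _]mulrDl; set d1 := D / _; set d2 := 2 / _; set X := (1 - q) * C * L.
  by rewrite !ler_norml => ? ? ? /andP[? ?] /andP[? ?]; lra.
(* From [n0] on, the defect [t] = N^(-e) of the lower bound is at most 1/2, which gives ln(1 - t) >=
   -2t. *)
pose n0 := (Num.truncn (2 * e^-1)).+1.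
apply: (@le_of_le_add_divn _ _ _ (expR e * D + 2 + 2 * e^-1) n0) => -[|J]// Jn _.
have := JB J; have := bB J.
have /andP[_ +] := block_bounds J.+1 e0; rewrite -/q.
have [_ zu] := ln_zeta_prod_bounds (exp_bound R J.+1) e0; move: zu.
have JR : 0 < J.+1%:R :> R by rewrite ltr0n.
have N0 : (0 < exp_bound R J.+1)%N by [].
have NR : 0 < (exp_bound R J.+1)%:R :> R by rewrite ltr0n.
pose t := (exp_bound R J.+1)%:R `^ (- e).
have t0 : 0 < t by rewrite powR_gt0.
have tJ : t <= e^-1 / J.+1%:R.
  apply: le_trans (expRN_pow_le e0 (ltn0Sn J)).
  rewrite /t powRN -expRM_natl mulrN expRN lef_pV2 ?posrE ?powR_gt0 ?expR_gt0//.
  rewrite expRM.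
  by apply: ge0_ler_powR; rewrite ?nnegrE ?expR_ge0 ?(ltW e0) ?exp_bound_ge.
have t2 : t <= 2^-1.
  apply: (le_trans tJ); rewrite ler_pdivrMr//.
  have : 2 * e^-1 < J.+1%:R.
    apply: lt_le_trans (_ : n0%:R <= _); last by rewrite ler_nat.
    by apply: real_truncnS_gt; rewrite num_real.
  lra.
have : ln (1 - t) - ln e <= ln (zeta_prod e (exp_bound R J.+1)).
  rewrite -ln_div ?posrE//; last by lra.
  rewrite ler_ln ?posrE ?zeta_prod_gt0 ?divr_gt0//; last by lra.
  by apply: le_trans (zeta_sum_ge e0 N0) _; exact: zeta_prod_ge.
have t1 : - (2 * (e^-1 / J.+1%:R)) <= ln (1 - t).
  have u0 : 0 < 1 - t by lra.
  have := ln_ge_1subV u0.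
  have : (1 - t)^-1 <= 1 + 2 * t.
    rewrite -div1r ler_pdivrMr//.
    have : 0 <= t * (2^-1 - t) by rewrite mulr_ge0//; lra.
    lra.
  by move: tJ; set d := e^-1 / _; set w := (1 - t)^-1; lra.
set W := ln (zeta_prod _ _).
set g := prime_log_gap R _; set T := block_sum _ _.
have -> : (expR e * D + 2 + 2 * e^-1) / J.+1%:R =
  expR e * (D / J.+1%:R) + 2 / J.+1%:R + 2 * (e^-1 / J.+1%:R) by ring.
set d1 := D / _; set d2 := 2 / _; set X := (1 - q) * C * L.
set d3 := e^-1 / _ in t1 *.
rewrite !ler_norml => h1 h2 h3 /andP[h4 h5] /andP[h6 h7].
have : expR e * T <= expR e * (L + s * q + X + d1) by rewrite ler_pM2l ?expR_gt0//; lra.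
rewrite mulrDr; lra.
Qed.

Lemma expR_le_1D2x (R : realType) (e : R) : 0 <= e <= 2^-1 -> expR e <= 1 + 2 * e.
Proof.
move=> /andP[e0 e1]; rewrite -[expR e]invrK -expRN -div1r ler_pdivrMr ?expR_gt0//.
have h := expR_ge1Dx (- e).
apply: (@le_trans _ _ ((1 + 2 * e) * (1 - e))); last by rewrite ler_wpM2l//; lra.
have : 0 <= e * (2^-1 - e) by rewrite mulr_ge0//; lra.
lra.
Qed.

(** As [e] tends to 0, 1 - q is e + O(e^2), so [L] cancels against -ln e and only the constants
    remain in the two bounds of the sandwich. *)
Lemma mertens_constant (R : realType) (M C : R) : 0 <= C ->
  (forall j, `|prime_recip R j.+1 - \sum_(1 <= i < j.+2) i%:R^-1 - (M - euler_gamma R)|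
     <= C / j.+1%:R) -> M = mertens_B1 R.
Proof.
move=> C0 HC; have [K K0 HK] := sum_ln_prime_bounded R.
apply/eqP; rewrite -subr_eq0; apply/eqP.
set s := M - euler_gamma R in HC.
rewrite /mertens_B1 -/(prime_log_gap R) opprD addrA -/s.
rewrite (_ : limn _ = limn (prime_log_gap R))//.
set b := limn _.
apply: (@eq0_of_le_divn _ _ (`|s| + 3 * C + K + 1 + 1 + 6 * (1 + C)) 2) => n n2 _.
have nR : 2 <= n%:R :> R by rewrite ler_nat.
have n0 : 0 < n%:R :> R by lra.
pose v : R := n%:R^-1; have v0 : 0 < v by rewrite invr_gt0.
have v1 : v <= 2^-1 by rewrite lef_pV2 ?posrE.
(* With e = 1/n^2, the inequality ln n <= n makes e * ln(1/e) an O(1/n), so every error has the form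
   C / n. *)
pose e := v ^+ 2; have e0 : 0 < e by rewrite exprn_gt0.
have ev : e <= v by rewrite /e expr2 ler_piMr//; lra.
have := mertens_constant_sandwich C0 HC HK e0.
rewrite /= -/s -/b; set q := expR (- e); set L := - ln (1 - q).
have q0 : 0 < q by exact: expR_gt0.
have q1 : q < 1 by rewrite /q expR_lt1; lra.
have qe : 1 - q <= e by have := expR_ge1Dx (- e); rewrite -/q; lra.
have EQ : expR e * q = 1 by rewrite expRxMexpNx_1.
have eE : expR e <= 1 + 2 * e by apply: expR_le_1D2x; lra.
have eE1 : 1 + e <= expR e by exact: expR_ge1Dx.
have qe2 : q * e <= 1 - q.
  have : q * (1 + e) <= q * expR e by rewrite ler_pM2l.
  by rewrite [q * expR e]mulrC EQ; lra.
have L1 : - ln e <= L by rewrite lerN2 ler_ln ?posrE//; lra.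
have L2 : L <= - ln e + e.
  rewrite /L lerNl opprD opprK; apply: le_trans (_ : ln (q * e) <= _).
    by rewrite lnM ?posrE// /q expRK addrC.
  by rewrite ler_ln ?posrE ?mulr_gt0//; lra.
have lnE : - ln e = 2 * ln n%:R.
  by rewrite /e /v exprVn lnV ?posrE ?exprn_gt0// opprK lnXn// mulr_natl.
have ln0 : 0 <= ln n%:R :> R by rewrite ln_ge0//; lra.
have lnn : ln n%:R <= n%:R - 1 :> R by exact: ln_le_subr1.
have L0 : 0 <= L by lra.
have eL : e * L <= 3 * v.
  apply: (@le_trans _ _ (e * (3 * n%:R))); first by rewrite ler_wpM2l; lra.
  by rewrite /e /v expr2 le_eqVlt; apply/orP; left; apply/eqP; field; rewrite gt_eqF.
have eL0 : 0 <= e * L by rewrite mulr_ge0// ltW.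
move=> [h1 h2].
have h3 : ln (1 + e^-1) <= e - ln e.
  have -> : 1 + e^-1 = (1 + e) / e by field; rewrite gt_eqF.
  rewrite ln_div ?posrE//; last by lra.
  have : 0 < 1 + e by lra.
  by move/ln_le_subr1; lra.
have k1 : (1 - q) * C * L <= 3 * C * v.
  apply: (@le_trans _ _ (C * (e * L))); last first.
    by rewrite [leRHS](_ : _ = C * (3 * v)) ?ler_wpM2l//; ring.
  rewrite [leLHS](_ : _ = C * ((1 - q) * L)); last by ring.
  by rewrite ler_wpM2l// ler_wpM2r.
have k2 : - (`|s| * v) <= s * q - s <= `|s| * v.
  rewrite -ler_norml -[X in _ - X]mulr1 -mulrBr normrM ler_wpM2l//.
  rewrite distrC ger0_norm; lra.
have k3 : e * K <= K * v by rewrite mulrC ler_wpM2l// ltW.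
have k4 : expR e * (L + s * q + (1 - q) * C * L) <= L + s + (1 + C) * (6 * v).
  have -> : expR e * (L + s * q + (1 - q) * C * L) =
     L + s * (expR e * q) + (expR e - 1) * L + (expR e - expR e * q) * (C * L) by ring.
  rewrite EQ mulr1.
  have a1 : (expR e - 1) * L <= 2 * (e * L).
    by rewrite mulrA ler_wpM2r//; lra.
  have a2 : (expR e - 1) * (C * L) <= C * (2 * (e * L)).
    by rewrite mulrCA ler_wpM2l.
  have a3 : C * (2 * (e * L)) <= C * (6 * v) by rewrite ler_wpM2l//; lra.
  lra.
have cv : 0 <= C * v by rewrite mulr_ge0// ltW.
have kv : 0 <= K * v by rewrite mulr_ge0// ltW.
have sv : 0 <= `|s| * v by rewrite mulr_ge0// ltW.
rewrite -/v ler_norml; move/andP: k2 => [k2 k2'].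
by apply/andP; split; lra.
Qed.

Lemma mertens_second_B1 (R : realType) : exists2 C : R, 0 <= C & forall x : R, 2 <= x ->
  `|\sum_(0 <= p < (Num.truncn x).+1 | prime p) p%:R^-1 - ln (ln x) - mertens_B1 R|
    <= C / ln x.
Proof.
have [M [C [C0 HC]]] := mertens_second_real R; exists C => // x x2.
have C1 : 0 <= C + 1 by lra.
by rewrite -(mertens_constant C1 (prime_recip_harmonic C0 HC)); exact: HC.
Qed.

(** * Sums over primes and the final estimates *)

Definition Lh_term (R : realType) (h : nat) (r : R) (p : nat) : R :=
  (p%:R `^ (r / h%:R - 1) * (p%:R - p%:R `^ (1 - h%:R^-1) + 1))^-1.

(** Keeps the denominator common to [coprime_density] and [Lh_term] away from 0 uniformly in [p]. It
    follows from 1 - t^h <= h * (1 - t). *)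
Lemma one_sub_root_ge (R : realType) (h : nat) (t : R) : (0 < h)%N -> 0 < t -> t < 1 ->
  h%:R^-1 <= 1 - t + t ^+ h.
Proof.
move=> h0 t0 t1; have hR : 1 <= h%:R :> R by rewrite ler1n.
have h1 : 0 < h%:R :> R by lra.
rewrite -div1r ler_pdivrMr//.
have := subrX1 t h; set S := \sum_(i < h) _ => E.
have Sh : S <= h%:R.
  rewrite -[h%:R]mulr1 mulr_natl -[X in 1 *+ X]card_ord -sumr_const.
  by apply: ler_sum => i _; rewrite exprn_ile1// ltW.
have th : 0 <= t ^+ h by rewrite exprn_ge0// ltW.
have a1 : 1 - t ^+ h <= (1 - t) * h%:R.
  have : 1 - t ^+ h = (1 - t) * S by rewrite -[LHS]opprB E; ring.
  by move=> ->; rewrite ler_wpM2l//; lra.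
have : t ^+ h <= t ^+ h * h%:R by rewrite ler_peMr.
lra.
Qed.

Lemma Lh_termE (R : realType) (h k p : nat) : (0 < h)%N -> prime p ->
  let t := p%:R `^ (- h%:R^-1) : R in
  Lh_term h k%:R p = t ^+ k / (1 - t + t ^+ h).
Proof.
move=> h0 pp t; have [t0 t1 th _] := prime_root_lt1 R h0 pp.
rewrite -/t in t0 t1 th.
have hR : 0 < h%:R :> R by rewrite ltr0n.
have p0 : 0 < p%:R :> R by rewrite ltr0n prime_gt0.
have D0 := lt_le_trans (_ : 0 < h%:R^-1) (one_sub_root_ge h0 t0 t1).
have {}D0 : 0 < 1 - t + t ^+ h by apply: D0; rewrite invr_gt0.
have tE n : t ^- n = p%:R `^ (n%:R / h%:R).
  by rewrite -powR_mulrn ?ltW// -powRN /t -powRrM mulrNN mulrC.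
have pE : p%:R = t ^- h :> R by rewrite tE divff ?gt_eqF// powRr1// ltW.
rewrite /Lh_term powRD; last by rewrite (gt_eqF p0) implybT.
rewrite -tE powRV// (powRD (x := p%:R)) ?powRr1 ?ltW//; last first.
  by rewrite (gt_eqF p0) implybT.
rewrite -/t pE.
have u0 : t ^+ h != 0 by rewrite expf_neq0// gt_eqF.
have v0 : t ^+ k != 0 by rewrite expf_neq0// gt_eqF.
set u := t ^+ h in D0 u0 *; set v := t ^+ k in v0 *.
by field; rewrite v0 u0 /=; apply/andP; split; lra.
Qed.

(** The Euler factor equals (1 - t^h) * (1 - t + t^h) / (1 - t), and 1 - t^h is 1 - 1/p, which
    cancels. *)
Lemma coprime_densityE (R : realType) (h p : nat) : (0 < h)%N -> prime p ->
  let t := p%:R `^ (- h%:R^-1) : R in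
  coprime_density R h p = (1 - t) / (1 - t + t ^+ h).
Proof.
move=> h0 pp t; have [t0 t1 th _] := prime_root_lt1 R h0 pp.
rewrite -/t in t0 t1 th.
have p0 : 0 < p%:R :> R by rewrite ltr0n prime_gt0.
have p1 : 1 < p%:R :> R by rewrite ltr1n prime_gt1.
have D0 := lt_le_trans (_ : 0 < h%:R^-1) (one_sub_root_ge h0 t0 t1).
have {}D0 : 0 < 1 - t + t ^+ h by apply: D0; rewrite invr_gt0 ltr0n.
rewrite /coprime_density local_factorE//.
have -> : p%:R `^ h%:R^-1 = t^-1 :> R by rewrite /t powRN invrK.
rewrite -th; have -> : p%:R = (t ^+ h)^-1 :> R by rewrite th invrK.
have u1 : t ^+ h < 1 by rewrite th invf_lt1.
have u0 : 0 < t ^+ h by rewrite exprn_gt0.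
set u := t ^+ h in D0 u0 u1 *.
have -> : 1 + (u^-1 - t^-1) / (u^-1 ^+ 2 * (t^-1 - 1)) = (1 - u) * (1 - t + u) / (1 - t).
  by field; rewrite !gt_eqF//=; lra.
by field; rewrite !gt_eqF//=; lra.
Qed.

Lemma prime_powX_root (R : realType) (h k p : nat) :
  (p%:R ^+ k) `^ (- h%:R^-1) = (p%:R `^ (- h%:R^-1)) ^+ k :> R.
Proof. by rewrite -natrX powR_natX. Qed.

Lemma density_Lh_term (R : realType) (h k p : nat) : (0 < h)%N -> prime p ->
  coprime_density R h p * (p%:R ^+ k) `^ (- h%:R^-1) =
  Lh_term h k%:R p - Lh_term h k.+1%:R p.
Proof.
move=> h0 pp; rewrite prime_powX_root coprime_densityE// !Lh_termE// exprS.
ring.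
Qed.

Lemma density_Lh_term_2h (R : realType) (h p : nat) : (0 < h)%N -> prime p ->
  coprime_density R h p * (p%:R ^+ h) `^ (- h%:R^-1) =
  p%:R^-1 - Lh_term h (2 * h)%N%:R p.
Proof.
move=> h0 pp; rewrite prime_powX_root coprime_densityE// !Lh_termE//.
have [t0 t1 th _] := prime_root_lt1 R h0 pp; rewrite -th.
set t := _ `^ _ in t0 t1 th *; rewrite mulnC exprM.
have D0 := lt_le_trans (_ : 0 < h%:R^-1) (one_sub_root_ge h0 t0 t1).
have {}D0 : 0 < 1 - t + t ^+ h by apply: D0; rewrite invr_gt0 ltr0n.
by field; rewrite gt_eqF.
Qed.

Lemma Lh_term_bounds (R : realType) (h k p : nat) : (0 < h)%N -> prime p ->
  0 <= (Lh_term h k%:R p : R) <= h%:R * p%:R `^ (- (k%:R / h%:R)).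
Proof.
move=> h0 pp; have hR : 0 < h%:R :> R by rewrite ltr0n.
have [t0 t1 _ _] := prime_root_lt1 R h0 pp.
rewrite Lh_termE//; set t := _ `^ (- h%:R^-1) in t0 t1 *.
have -> : p%:R `^ (- (k%:R / h%:R)) = t ^+ k.
  by rewrite -powR_mulrn ?ltW// /t -powRrM mulNr mulrC.
have D := one_sub_root_ge h0 t0 t1.
have D0 : 0 < 1 - t + t ^+ h by apply: lt_le_trans D; rewrite invr_gt0.
have tk : 0 <= t ^+ k by rewrite exprn_ge0// ltW.
rewrite divr_ge0 ?(ltW D0)//= mulrC ler_wpM2r//.
by rewrite -[leRHS]invrK lef_pV2 ?posrE ?invr_gt0.
Qed.

Lemma prime_series_tail (R : realType) (s A : R) (a : nat -> R) : 0 < s ->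
  (forall p, prime p -> 0 <= a p <= A * p%:R `^ (- (1 + s))) ->
  let G N := \sum_(0 <= p < N | prime p) a p in
  cvgn G /\ exists2 K : R, 0 <= K & forall N, (0 < N)%N ->
    0 <= limn G - G N <= K * N%:R `^ (- s).
Proof.
move=> s0 aA G.
have A0 : 0 <= A.
  have /andP[a0 a1] := aA 2%N isT; have := le_trans a0 a1.
  by rewrite pmulr_lge0// powR_gt0.
have [K K0 HK] := sum_powR_tail s0.
have Gnd : nondecreasing_seq G.
  apply/nondecreasing_seqP => N; rewrite /G [leRHS]big_mkcond big_nat_recr//= -big_mkcond.
  by rewrite lerDl; case: ifPn => // /aA /andP[].
have GD N m : (0 < N)%N -> (N <= m)%N -> G m - G N <= A * K * 2 `^ s * N%:R `^ (- s).
  move=> N0 Nm; rewrite /G (@big_cat_nat _ _ _ N 0 m)//= addrAC subrr add0r.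
  (* [sum_powR_tail] needs a strict lower bound whereas [p] starts at [N]. Half of [N] serves, at
     the cost of 2^s. *)
  have N2 : 0 < N%:R / 2 :> R by rewrite divr_gt0// ltr0n.
  have -> : A * K * 2 `^ s * N%:R `^ (- s) = A * (K * (N%:R / 2) `^ (- s)).
    by rewrite powRM// powR_invl// opprK; ring.
  apply: le_trans (_ : A *
    (\sum_(0 <= n < m | N%:R / 2 < n%:R) n%:R `^ (- (1 + s))) <= _); last first.
    exact: ler_wpM2l A0 _ _ (HK _ m N2).
  rewrite mulr_sumr.
  apply: (@le_trans _ _ (\sum_(N <= p < m | prime p) A * p%:R `^ (- (1 + s)))).
    by apply: ler_sum => p /aA /andP[].
  rewrite -big_filter -[leRHS]big_filter; apply: ler_sum_subset.
  - by rewrite filter_uniq// iota_uniq.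
  - by rewrite filter_uniq// iota_uniq.
  - move=> n; rewrite !mem_filter !mem_index_iota => /andP[_ /andP[Nn ->]].
    rewrite /= andbT; apply: (@lt_le_trans _ _ N%:R); last by rewrite ler_nat.
    by rewrite ltr_pdivrMr// ltr_pMr ?ltr0n// ltr1n.
  - by move=> n; rewrite mulr_ge0 ?powR_ge0.
set B := A * K * 2 `^ s in GD.
have B0 : 0 <= B by rewrite !mulr_ge0 ?powR_ge0 ?(ltW K0).
have cG : cvgn G.
  apply: nondecreasing_is_cvgn => //; exists (G 1%N + B) => _ [[|N] _ <-].
    by apply: le_trans (Gnd 0%N 1%N isT) _; rewrite lerDl.
  by have := GD 1%N N.+1 isT isT; rewrite powR1 mulr1; lra.
split=> //; exists B => // N N0; apply/andP; split.
  rewrite subr_ge0; apply: (limn_ge_from (n0 := N) cG) => m; exact: Gnd.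
rewrite lerBlDr addrC -lerBlDr; rewrite lerBlDr; apply: (limn_le_from (n0 := N) cG) => m Nm.
by have := GD N m N0 Nm; lra.
Qed.

Lemma abel_sum_le (R : realDomainType) (a f : nat -> R) (c : R) (N : nat) :
  a 0%N = 0 -> (forall n, \sum_(0 <= i < n.+1) a i <= n%:R * c) ->
  (forall n, 0 <= f n) -> (forall n, (0 < n)%N -> f n.+1 <= f n) ->
  \sum_(0 <= i < N.+1) a i * f i <= c * \sum_(0 <= n < N) f n.+1.
Proof.
move=> a0 aA f0 fd; pose A n := \sum_(0 <= i < n.+1) a i.
(* The boundary term of the summation by parts is nonpositive, but the induction needs it. *)
suff H : \sum_(0 <= i < N.+1) a i * f i <=
    c * \sum_(0 <= n < N) f n.+1 + (A N - N%:R * c) * f N.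
  apply: le_trans H _; rewrite gerDl mulr_le0_ge0// subr_le0; exact: aA.
elim: N => [|N IHN].
  by rewrite /A !big_nat1 big_nil a0 !mul0r mulr0 subrr mul0r addr0.
rewrite big_nat_recr//= [X in c * X]big_nat_recr//=.
have AS : A N.+1 = A N + a N.+1 by rewrite /A big_nat_recr.
have k : (A N - N%:R * c) * f N <= (A N - N%:R * c) * f N.+1.
  case: N {IHN AS} => [|N]; first by rewrite /A big_nat1 a0 mul0r subrr !mul0r.
  by apply: ler_wnM2l; rewrite ?subr_le0 ?aA// fd.
rewrite AS -natr1; lra.
Qed.

(** Chebyshev's bound and summation by parts give O(z^b) for the sum weighted by ln p. That weight
    is at least (ln z)/2 once p >= sqrt z, which gains the logarithm. *)
Lemma sum_prime_powR_le (R : realType) (b : R) : 0 < b -> b < 1 ->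
  exists2 C : R, 0 <= C & forall z : R, 2 <= z ->
  \sum_(0 <= p < (Num.truncn z).+1 | prime p) p%:R `^ (b - 1) <= C * (z `^ b / ln z).
Proof.
move=> b0 b1; have l4 : 0 <= ln 4 :> R by rewrite ln_ge0//; lra.
pose C1 : R := 2 * (ln 4 * (2 / b)); pose C2 : R := (2 / (b / 2)) * (4 / b).
have C10 : 0 <= C1 by rewrite !mulr_ge0 ?invr_ge0 ?(ltW b0).
have C20 : 0 <= C2 by rewrite !mulr_ge0 ?invr_ge0 ?mulr_ge0 ?invr_ge0 ?(ltW b0).
exists (C1 + C2) => [|z z2]; first by rewrite addr_ge0.
have z0 : 0 < z by lra.
have lz : 0 < ln z by rewrite ln_gt0//; lra.
set Z := Num.truncn z; have /andP[Zz _] := truncn_itv (ltW z0); rewrite -/Z in Zz.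
have Zp s : 0 < s -> Z%:R `^ s <= z `^ s.
  by move=> s0; apply: ge0_ler_powR; rewrite ?nnegrE ?(ltW s0) ?(ltW z0).
apply: (@le_trans _ _ (\sum_(0 <= p < Z.+1 | prime p)
   (2 / ln z * (ln p%:R * p%:R `^ (b - 1)) + z `^ (b / 4) * p%:R `^ (b / 2 - 1)))).
  rewrite big_nat_cond [leRHS]big_nat_cond; apply: ler_sum => p /andP[/andP[_ pZ] pp].
  have p1 : 1 < p%:R :> R by rewrite ltr1n prime_gt1.
  have p0 : 0 < p%:R :> R by lra.
  have lp : 0 < ln p%:R :> R by rewrite ln_gt0.
  have t0 := powR_ge0 p%:R (b - 1).
  have w0 : 0 <= z `^ (b / 4) * p%:R `^ (b / 2 - 1) by rewrite mulr_ge0 ?powR_ge0.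
  (* The first term takes care of [sqrt z <= p], the second one of [p < sqrt z]. *)
  have [h|h] := leP (ln z) (2 * ln p%:R).
    have : p%:R `^ (b - 1) <= 2 / ln z * (ln p%:R * p%:R `^ (b - 1)).
      rewrite mulrA ler_peMl// mulrAC ler_pdivlMr// mul1r//.
    lra.
  have : p%:R `^ (b - 1) <= z `^ (b / 4) * p%:R `^ (b / 2 - 1).
    rewrite /powR !gt_eqF// -expRD ler_expR.
    have : b / 4 * (2 * ln p%:R) <= b / 4 * ln z by rewrite ler_wpM2l ?ltW ?divr_gt0.
    lra.
  have : 0 <= 2 / ln z * (ln p%:R * p%:R `^ (b - 1)).
    by apply: mulr_ge0; [rewrite divr_ge0// ltW|rewrite mulr_ge0// ltW].
  lra.
rewrite big_split -!mulr_sumr /= [(C1 + C2) * _]mulrDl; apply: lerD.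
  have e1 : \sum_(0 <= p < Z.+1 | prime p) ln p%:R * p%:R `^ (b - 1) <=
     ln 4 * (2 / b * z `^ b).
    rewrite big_mkcond /=.
    pose a p := if prime p then ln p%:R else 0 : R.
    pose f (n : nat) := if n is 0%N then 0 else n%:R `^ (b - 1) : R.
    apply: (@le_trans _ _ (\sum_(0 <= i < Z.+1) a i * f i)).
      apply: ler_sum => -[|p] _ //=; first by rewrite /a /= mul0r.
      by rewrite /a /f; case: ifP => _; rewrite ?mul0r.
    apply: le_trans (@abel_sum_le _ a f (ln 4) Z _ _ _ _) _ => //.
    - by move=> n; rewrite /a -big_mkcond; exact: chebyshev_theta.
    - by case=> [|n] //=; exact: powR_ge0.
    - case=> // n _; rewrite /f -[b - 1]opprK !(powRN _ (- (b - 1))).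
      rewrite lef_pV2 ?posrE ?powR_gt0 ?ltr0n//.
      by apply: ge0_ler_powR; rewrite ?nnegrE ?ler_nat//; lra.
    rewrite ler_wpM2l//; apply: le_trans (sum_powR_le Z _) _; first by rewrite b0 ltW.
    by rewrite ler_wpM2l ?divr_ge0 ?(ltW b0) ?Zp.
  rewrite [leRHS](_ : _ = 2 / ln z * (ln 4 * (2 / b * z `^ b))); last by rewrite /C1; ring.
  by rewrite ler_wpM2l// divr_ge0// ltW.
have b2 : 0 < b / 2 <= 1 by lra.
have e2 : \sum_(0 <= p < Z.+1 | prime p) p%:R `^ (b / 2 - 1) <= 2 / (b / 2) * z `^ (b / 2).
  apply: (@le_trans _ _ (\sum_(0 <= n < Z) n.+1%:R `^ (b / 2 - 1))).
    rewrite big_mkcond big_nat_recl//= add0r; apply: ler_sum => n _.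
    by case: ifP => _; rewrite ?powR_ge0.
  apply: le_trans (sum_powR_le Z b2) _.
  by rewrite ler_wpM2l ?divr_ge0 ?(ltW b0) ?Zp//; lra.
apply: (@le_trans _ _ (z `^ (b / 4) * (2 / (b / 2) * z `^ (b / 2)))).
  by rewrite ler_wpM2l ?powR_ge0.
(* The primes below sqrt z contribute only O(z^(3b/4)), and the missing z^(b/4) absorbs ln z. *)
have e3 : ln z <= 4 / b * z `^ (b / 4).
  have := ln_sublinear (powR_gt0 (b / 4) z0); rewrite ln_powR => H.
  rewrite -ler_pdivrMl ?divr_gt0// invf_div; lra.
have -> : z `^ b = z `^ (b / 4) * z `^ (b / 4) * z `^ (b / 2).
  by rewrite -!powRD ?(gt_eqF z0) ?implybT//; congr (_ `^ _); field.
rewrite mulrA ler_pdivlMr//.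
set t := z `^ (b / 4) in e3 *; set u := z `^ (b / 2); set w := 2 / (b / 2).
have t0 : 0 <= t by exact: powR_ge0.
have u0 : 0 <= u by exact: powR_ge0.
have w0 : 0 <= w by rewrite divr_ge0//; lra.
rewrite [leRHS](_ : _ = t * (w * u) * (4 / b * t)); last by rewrite /C2 -/w; ring.
by rewrite ler_wpM2l// mulr_ge0// mulr_ge0.
Qed.

(** * Assembling the asymptotic estimates *)

Lemma eqaddO_pinfty (R : realType) (f g e : R -> R) (C x0 : R) : 0 <= C ->
  (forall x, x0 <= x -> `|f x - g x| <= C * e x) -> f = g +O_+oo e.
Proof.
move=> C0 H; apply/eqaddOP; near=> k; near=> x.
rewrite !fctE; apply: (@le_trans _ _ (C * e x)).
  by apply: H; near: x; apply: nbhs_pinfty_ge; rewrite num_real.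
apply: (@le_trans _ _ (C * `|e x|)); first by rewrite ler_wpM2l ?ler_norm.
by rewrite ler_wpM2r//; near: k; apply: nbhs_pinfty_ge; rewrite num_real.
Unshelve. all: by end_near. Qed.

(** The cutoff [N] is left free: it will be just above x when [k > h], and just above x^(1/h) when
    [k = h]. *)
Lemma sum_h_full_count_dist (R : realType) (h k : nat) : (0 < h)%N ->
  exists2 C : R, 0 <= C & forall (x : R) (N : nat), 0 < x ->
  `|\sum_(0 <= p < N | prime p) h_full_count h p (x / p%:R ^+ k) -
    gamma0 R h * x `^ h%:R^-1 *
      \sum_(0 <= p < N | prime p) coprime_density R h p * (p%:R ^+ k) `^ (- h%:R^-1)|
  <= C * x `^ h.+1%:R^-1 * \sum_(0 <= p < N | prime p) p%:R `^ (- (k%:R / h.+1%:R)).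
Proof.
move=> h0; have [C C0 HC] := h_full_count_dist R h0; exists C => // x N x0.
rewrite !mulr_sumr -sumrB; apply: le_trans (ler_norm_sum _ _ _) _.
apply: ler_sum => p pp; have p0 : 0 < p%:R :> R by rewrite ltr0n prime_gt0.
have pk : 0 < p%:R ^+ k :> R by rewrite exprn_gt0.
have y0 : 0 < x / p%:R ^+ k by rewrite divr_gt0.
have := HC p _ pp y0.
rewrite ![(x / _) `^ _]powRM ?invr_ge0 ?(ltW pk) ?(ltW x0)// !powR_invl//.
have -> : (p%:R ^+ k) `^ (- h.+1%:R^-1) = p%:R `^ (- (k%:R / h.+1%:R)) :> R.
  by rewrite -powR_mulrn ?(ltW p0)// -powRrM mulrN.
rewrite [C * (_ * _)]mulrA; congr (`|_ - _| <= _); ring.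
Qed.

Lemma h_full_count_lt1 (R : realType) (h p : nat) (y : R) : 0 <= y < 1 ->
  h_full_count h p y = 0.
Proof.
move=> y01; rewrite /h_full_count; have -> : Num.truncn y = 0%N.
  by apply: truncn_def.
by rewrite big_mkcond big_nat1.
Qed.

Lemma Lh_tail (R : realType) (h k : nat) : (0 < h)%N -> (h < k)%N ->
  exists2 K : R, 0 <= K & forall N, (0 < N)%N ->
  0 <= Lh h (k%:R : R) - \sum_(0 <= p < N | prime p) Lh_term h k%:R p
    <= K * N%:R `^ (- (k%:R / h%:R - 1)).
Proof.
move=> h0 hk; have hR : 0 < h%:R :> R by rewrite ltr0n.
have s0 : 0 < k%:R / h%:R - 1 :> R by rewrite subr_gt0 ltr_pdivlMr// mul1r ltr_nat.
have [|_ [K K0 HK]] := @prime_series_tail R _ h%:R (Lh_term h k%:R) s0.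
  move=> p pp; rewrite [1 + _](_ : _ = k%:R / h%:R); last by ring.
  exact: Lh_term_bounds.
by exists K.
Qed.

Lemma Lh_sub_tail (R : realType) (h k : nat) : (0 < h)%N -> (h < k)%N ->
  exists2 K : R, 0 <= K & forall N, (0 < N)%N ->
  `|\sum_(0 <= p < N | prime p) (Lh_term h k%:R p - Lh_term h k.+1%:R p : R)
    - (Lh h k%:R - Lh h k.+1%:R)| <= K * N%:R `^ (- (k%:R / h%:R - 1)).
Proof.
move=> h0 hk; have hR : 0 < h%:R :> R by rewrite ltr0n.
have [K1 K10 H1] := Lh_tail R h0 hk; have [K2 K20 H2] := Lh_tail R h0 (ltnW hk : (h < k.+1)%N).
exists (K1 + K2) => [|N N0]; first exact: addr_ge0.
have N1 : 1 <= N%:R :> R by rewrite ler1n.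
have /andP[a1 a2] := H1 N N0; have /andP[b1 b2] := H2 N N0.
have m : N%:R `^ (- (k.+1%:R / h%:R - 1)) <= N%:R `^ (- (k%:R / h%:R - 1)) :> R.
  by apply: ler_powR => //; rewrite lerN2 lerD2r ler_pM2r ?invr_gt0// ler_nat.
have m2 := ler_wpM2l K20 m; move: m2 {m} => m2.
rewrite sumrB [(K1 + K2) * _]mulrDl.
move: (Lh h (k%:R : R)) (Lh h (k.+1%:R : R)) (\sum_(0 <= p < N | prime p) Lh_term h (k%:R : R) p)
  (\sum_(0 <= p < N | prime p) Lh_term h (k.+1%:R : R) p)
  (N%:R `^ (- (k%:R / h%:R - 1)) : R) (N%:R `^ (- (k.+1%:R / h%:R - 1)) : R)
  m2 a1 a2 b1 b2 => L1 L2 S1 S2 u v *.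
by rewrite ler_norml; apply/andP; split; lra.
Qed.

(** Treats [k = h.+1] and larger [k] at once: the sum left in the error is that of 1/p in the former
    case and converges in the latter. *)
Lemma sum_omega_gt (R : realType) (h k : nat) : (0 < h)%N -> (h < k)%N ->
  exists2 C : R, 0 <= C & forall x : R, 1 <= x ->
  `|sum_omega h k x - (Lh h k%:R - Lh h k.+1%:R) * gamma0 R h * x `^ h%:R^-1|
  <= C * x `^ h.+1%:R^-1 *
     (1 + \sum_(0 <= p < (Num.truncn x).+1 | prime p) p%:R `^ (- (k%:R / h.+1%:R))).
Proof.
move=> h0 hk; have hR : 0 < h%:R :> R by rewrite ltr0n.
have [C C0 HC] := sum_h_full_count_dist R k h0.
have [K K0 HK] := Lh_sub_tail R h0 hk.
have g0 : 0 <= gamma0 R h.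
  by apply: le_trans (prod_local_factor_le_gamma0 R 0 h0); rewrite big_nil.
exists (C + gamma0 R h * K) => [|x x1]; first by rewrite addr_ge0// mulr_ge0.
have x0 : 0 < x by lra.
rewrite sum_omegaE ?(ltW x0) ?(ltnW hk)//.
set N := (Num.truncn x).+1; have := HC x N x0.
rewrite (eq_bigr _ (fun p pp => density_Lh_term R k h0 pp)).
have := HK N isT.
set S := \sum_(_ <= _ < _ | _) h_full_count _ _ _.
set D := \sum_(_ <= _ < _ | _) (_ - _).
set E := \sum_(_ <= _ < _ | _) _ `^ _.
have E0 : 0 <= E by apply: sumr_ge0 => p _; exact: powR_ge0.
set G := gamma0 R h in g0 *; set L := Lh _ _ - _; set u := x `^ h%:R^-1.
set v := x `^ h.+1%:R^-1.
have v1 : 1 <= v by rewrite -(powRr0 x) ler_powR// invr_ge0.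
have u0 : 0 <= u by exact: powR_ge0.
have xN : x <= N%:R by apply: ltW; apply: real_truncnS_gt; rewrite num_real.
(* As k >= h + 1, the exponent k/h - 1 is at least 1/h: truncating the series near x costs O(1)
   after multiplication by x^(1/h). *)
have uN : u * N%:R `^ (- (k%:R / h%:R - 1)) <= 1.
  apply: (@le_trans _ _ (u * x `^ (- h%:R^-1))); last first.
    by rewrite /u -powRD ?(gt_eqF x0) ?implybT// subrr powRr0.
  rewrite ler_wpM2l// !powRN lef_pV2 ?posrE ?powR_gt0//.
  apply: (@le_trans _ _ (x `^ (k%:R / h%:R - 1))).
    apply: ler_powR => //; rewrite lerBrDr -[X in _ + X](@divff _ h%:R) ?gt_eqF//.
    by rewrite -[X in X + _]mul1r -mulrDl ler_pM2r ?invr_gt0// addrC natr1 ler_nat.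
  apply: ge0_ler_powR; rewrite ?nnegrE ?(ltW x0)// subr_ge0.
  by rewrite ler_pdivlMr// mul1r ler_nat ltnW.
move=> HD HS.
have e2 : `|G * u * D - L * G * u| <= G * K * v.
  have -> : G * u * D - L * G * u = G * (u * (D - L)) by ring.
  rewrite !normrM (ger0_norm g0) (ger0_norm u0) -mulrA ler_wpM2l//.
  apply: (@le_trans _ _ (u * (K * N%:R `^ (- (k%:R / h%:R - 1))))).
    by rewrite ler_wpM2l.
  rewrite mulrCA ler_wpM2l//; exact: le_trans uN v1.
have -> : S - L * G * u = (S - G * u * D) + (G * u * D - L * G * u) by rewrite addrA subrK.
apply: le_trans (ler_normD _ _) _; apply: le_trans (lerD HS e2) _.
have Cv : 0 <= C * v by rewrite mulr_ge0//; lra.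
have GK : 0 <= G * K * v by rewrite !mulr_ge0//; lra.
have GKE : 0 <= G * K * v * E by rewrite mulr_ge0.
rewrite [leRHS](_ : _ = C * v * E + G * K * v + C * v + G * K * v * E); last by ring.
lra.
Qed.

(** The threshold 2^h makes z = x^(1/h) at least 2, as the estimates over primes up to z require. *)
Lemma sum_omega_h (R : realType) (h : nat) : (0 < h)%N ->
  exists2 C : R, 0 <= C & forall x : R, 2 `^ h%:R <= x ->
  `|sum_omega h h x - (gamma0 R h * x `^ h%:R^-1 * ln (ln x) +
     (mertens_B1 R - ln h%:R - Lh h (2 * h)%N%:R) * gamma0 R h * x `^ h%:R^-1)|
  <= C * (x `^ h%:R^-1 / ln x).
Proof.
move=> h0; have hR : 0 < h%:R :> R by rewrite ltr0n.
have h1 : 1 <= h%:R :> R by rewrite ler1n.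
have [C C0 HC] := sum_h_full_count_dist R h h0.
have h2 : (h < 2 * h)%N by rewrite ltn_Pmull.
have [K K0 HK] := Lh_tail R h0 h2.
have [M M0 HM] := mertens_second_B1 R.
have b0 : 0 < h.+1%:R^-1 :> R by rewrite invr_gt0.
have b1 : h.+1%:R^-1 < 1 :> R by rewrite invf_lt1// ltr1n.
have [P P0 HP] := sum_prime_powR_le b0 b1.
have g0 : 0 <= gamma0 R h.
  by apply: le_trans (prod_local_factor_le_gamma0 R 0 h0); rewrite big_nil.
exists (C * P * h%:R + gamma0 R h * (M * h%:R + K * h%:R)) => [|x x2].
  by rewrite addr_ge0 ?mulr_ge0 ?addr_ge0 ?mulr_ge0.
have x1 : 2 <= x.
  apply: le_trans x2; rewrite -[X in X <= _](@powRr1 _ 2)//.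
  by apply: ler_powR => //; lra.
have x0 : 0 < x by lra.
pose z := x `^ h%:R^-1; have z2 : 2 <= z.
  have -> : 2 = (2 `^ h%:R) `^ h%:R^-1 :> R by rewrite -powRrM divff ?gt_eqF// powRr1.
  by apply: ge0_ler_powR; rewrite ?nnegrE ?powR_ge0 ?invr_ge0 ?(ltW hR) ?(ltW x0).
have zx : z <= x.
  by rewrite -[leRHS]powRr1 ?(ltW x0)// ler_powR ?invf_le1//; lra.
have zE : z ^+ h = x.
  by rewrite -powR_mulrn ?powR_ge0// -powRrM mulVf ?gt_eqF// powRr1 ?(ltW x0).
have z0 : 0 < z by lra.
have lx : 0 < ln x by rewrite ln_gt0//; lra.
have lz : ln z = ln x / h%:R by rewrite ln_powR mulrC.
have lzi : (ln z)^-1 = h%:R / ln x by rewrite lz invf_div.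
set N := (Num.truncn z).+1.
(* Primes beyond [z] have x / p^h < 1 and contribute nothing. Stopping there matters, as the sums of
   1/p and of p^(-h/(h+1)) grow with the cutoff. *)
have -> : sum_omega h h x =
    \sum_(0 <= p < N | prime p) h_full_count h p (x / p%:R ^+ h).
  rewrite sum_omegaE ?(ltW x0)//.
  rewrite (@big_cat_nat _ _ _ N)//=; last by rewrite ltnS le_truncn.
  rewrite [X in _ + X]big_nat_cond [X in _ + X]big1 ?addr0// => p /andP[/andP[Np _] pp].
  have zp : z < p%:R.
    apply: lt_le_trans (_ : N%:R <= _); last by rewrite ler_nat.
    by apply: real_truncnS_gt; rewrite num_real.
  have p0 : 0 < p%:R :> R by lra.
  apply: h_full_count_lt1; rewrite divr_ge0 ?exprn_ge0 ?(ltW x0)//=.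
  rewrite ltr_pdivrMr ?exprn_gt0// mul1r -zE ltrXn2r// ?nnegrE ?(ltW z0)//.
  by rewrite -lt0n.
have := HC x N x0.
rewrite (eq_bigr _ (fun p pp => density_Lh_term_2h R h0 pp)) sumrB.
have /andP[] := HK N isT.
(* Here ln (ln z) becomes ln (ln x) - ln h, the origin of the -ln h in the constant. *)
have := HM z z2; rewrite -/N lz lnM ?posrE ?invr_gt0// lnV ?posrE//.
have := HP z z2; rewrite -/N.
have -> : h.+1%:R^-1 - 1 = - (h%:R / h.+1%:R) :> R.
  by rewrite -natr1; field; rewrite natr1 gt_eqF.
(* The exponents add up: 1/(h+1) + 1/(h(h+1)) = 1/h. *)
have xz : x `^ h.+1%:R^-1 * (z `^ h.+1%:R^-1 / ln z) = z * h%:R / ln x.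
  rewrite -mulrA -lzi mulrA; congr (_ / _).
  rewrite /z -powRrM -powRD ?(gt_eqF x0) ?implybT//; congr (_ `^ _).
  by rewrite -natr1; field; rewrite natr1 !gt_eqF.
set S := \sum_(_ <= _ < _ | _) h_full_count _ _ _.
set D := \sum_(_ <= _ < _ | _) _^-1.
set E := \sum_(_ <= _ < _ | _) _ `^ _.
set F := \sum_(_ <= _ < _ | _) Lh_term _ _ _.
set G := gamma0 R h in g0 *; set L := Lh _ _; set B := mertens_B1 R.
rewrite -/z.
have -> : (2 * h)%N%:R / h%:R - 1 = 1 :> R by rewrite natrM; field; rewrite gt_eqF.
(* The tail of the series for [Lh (2h)] is O(1/N), well below 1 / ln z. *)
have NK : K * N%:R `^ (-1) <= K * (h%:R / ln x).
  rewrite ler_wpM2l// powRV ?ltr0n// -lzi lef_pV2 ?posrE ?ltr0n ?lz ?divr_gt0// -lz.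
  apply: le_trans (ltW (ln_sublinear z0)) _.
  by apply: ltW; apply: real_truncnS_gt; rewrite num_real.
set w := (ln x)^-1 in NK xz *.
move=> HE HD HF0 HF1 HS.
have e1 : C * x `^ h.+1%:R^-1 * E <= C * P * h%:R * (z * w).
  apply: (@le_trans _ _ (C * x `^ h.+1%:R^-1 * (P * (z `^ h.+1%:R^-1 / ln z)))).
    by rewrite ler_wpM2l ?mulr_ge0 ?powR_ge0.
  rewrite [leLHS](_ : _ = C * P * (x `^ h.+1%:R^-1 * (z `^ h.+1%:R^-1 / ln z))); last by ring.
  by rewrite xz le_eqVlt; apply/orP; left; apply/eqP; ring.
have e2 : `|D - F - (ln (ln x) + (B - ln h%:R - L))| <= (M * h%:R + K * h%:R) * w.
  have -> : (M * h%:R + K * h%:R) * w = M * (h%:R * w) + K * (h%:R * w) by ring.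
  move: HD; have -> : M / (ln x / h%:R) = M * (h%:R * w).
    by rewrite /w; congr (_ * _); rewrite invf_div.
  have {NK}HF2 := le_trans HF1 NK.
  set m1 := M * _; set m2 := K * _ in HF2 *.
  by rewrite !ler_norml => /andP[? ?]; apply/andP; split; lra.
have -> : S - (G * z * ln (ln x) + (B - ln h%:R - L) * G * z) =
   (S - G * z * (D - F)) + G * z * (D - F - (ln (ln x) + (B - ln h%:R - L))) by ring.
apply: le_trans (ler_normD _ _) _; rewrite [leRHS](_ : _ = C * P * h%:R * (z * w) +
  G * z * ((M * h%:R + K * h%:R) * w)); last by ring.
apply: lerD; first exact: le_trans HS e1.
have gz : 0 <= G * z by rewrite mulr_ge0// ltW.
by rewrite normrM (ger0_norm gz) ler_wpM2l.
Qed.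

Theorem theorem1p3 (R : realType) (h : nat) (hh : (2 <= h)%N) :
  let D1 : R := mertens_B1 R - ln h%:R - Lh h (2 * h)%N%:R in
  [/\ @sum_omega R h h =
        (fun x : R => gamma0 R h * x `^ h%:R^-1 * ln (ln x)
                      + D1 * gamma0 R h * x `^ h%:R^-1)
        +O_+oo (fun x : R => x `^ h%:R^-1 / ln x),
      @sum_omega R h h.+1 =
        (fun x : R => (Lh h h.+1%:R - Lh h h.+2%:R) * gamma0 R h * x `^ h%:R^-1)
        +O_+oo (fun x : R => x `^ h.+1%:R^-1 * ln (ln x))
    & forall k : nat, (h.+1 < k)%N ->
      @sum_omega R h k =
        (fun x : R => (Lh h k%:R - Lh h k.+1%:R) * gamma0 R h * x `^ h%:R^-1)
        +O_+oo (fun x : R => x `^ h.+1%:R^-1)].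
Proof.
move=> D1; have h0 : (0 < h)%N by exact: ltnW.
have hS : 0 < h.+1%:R :> R by rewrite ltr0n.
split.
- by have [C C0 HC] := sum_omega_h R h0; exact: eqaddO_pinfty C0 HC.
- have [C C0 HC] := sum_omega_gt R h0 (ltnSn h).
  have [M M0 HM] := mertens_second_B1 R.
  pose B := `|mertens_B1 R|; have B0 : 0 <= B by exact: normr_ge0.
  (* Beyond exp(exp 1), ln (ln x) is at least 1, so that it absorbs all the constants. *)
  apply: (@eqaddO_pinfty _ _ _ _ (C * (2 + B + M)) (expR (expR 1))) => [|x xe].
    by rewrite mulr_ge0//; lra.
  have e2 : 2 <= expR 1 :> R by have := expR_ge1Dx (1 : R); lra.
  have x2 : 2 <= x by have := expR_ge1Dx (expR 1 : R); lra.
  have lx : expR 1 <= ln x.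
    by rewrite -[leLHS]expRK ler_ln ?posrE ?expR_gt0//; lra.
  have llx : 1 <= ln (ln x).
    by rewrite -[leLHS]expRK ler_ln ?posrE ?expR_gt0//; lra.
  have x1 : 1 <= x by lra.
  apply: le_trans (HC x x1) _.
  rewrite [leRHS](_ : _ = C * x `^ h.+1%:R^-1 * ((2 + B + M) * ln (ln x))); last by ring.
  (* For [k = h.+1] the exponent k/(h+1) is 1, and Mertens' theorem applies to the remaining sum. *)
  rewrite ler_wpM2l ?mulr_ge0 ?powR_ge0// divff ?gt_eqF//.
  under eq_bigr => p pp do rewrite powRV ?ltr0n ?prime_gt0//.
  have := HM x x2; set S := \sum_(_ <= _ < _ | _) _; set l := ln (ln x) in llx *.
  have Ml : M / ln x <= M * l.
    by rewrite ler_wpM2l// (le_trans _ llx)// invf_le1; lra.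
  have Bl : mertens_B1 R <= B * l.
    by apply: le_trans (ler_norm _) _; rewrite ler_peMr.
  by rewrite ler_norml => /andP[_ ?]; lra.
- move=> k hk; have hk' : (h < k)%N by exact: ltnW.
  have [C C0 HC] := sum_omega_gt R h0 hk'.
  have s0 : 0 < k%:R / h.+1%:R - 1 :> R.
    by rewrite subr_gt0 ltr_pdivlMr// mul1r ltr_nat.
  have [K K0 HK] := sum_powR_tail s0.
  (* The cutoff 1 lies below every prime, so the tail bound covers the whole convergent sum. *)
  apply: (@eqaddO_pinfty _ _ _ _ (C * (1 + K * 1 `^ (- (k%:R / h.+1%:R - 1)))) 1).
    by rewrite mulr_ge0// addr_ge0// mulr_ge0 ?powR_ge0 ?ltW.
  move=> x x1; apply: le_trans (HC x x1) _; rewrite mulrAC ler_wpM2r ?powR_ge0//.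
  rewrite ler_wpM2l// lerD2l; apply: le_trans (HK 1 (Num.truncn x).+1 ltr01).
  rewrite -big_filter -[leRHS]big_filter.
  rewrite [1 + (k%:R / h.+1%:R - 1)](_ : _ = k%:R / h.+1%:R); last by ring.
  apply: ler_sum_subset.
  + by rewrite filter_uniq// iota_uniq.
  + by rewrite filter_uniq// iota_uniq.
  + by move=> p; rewrite !mem_filter => /andP[pp ->]; rewrite ltr1n prime_gt1.
  + by move=> p; exact: powR_ge0.
Qed.
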